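(* Consider Problem $\widetilde{\mathrm P}$ (see context) with $\tilde g$ the zero function. 1. Suppose that either (a) $\widetilde F$ is the zero function and $\tilde h$ is a constant function, or (b) $\widetilde F$ is a constant function, $\widetilde F(V,t)=k$ for $V\in\mathbb{R}$, $t>0$, for some $k\in\mathbb{R}\setminus\{0\}$, $\widetilde\Phi$ is a locally integrable function in $\mathbb{R}^+$, and $\tilde h$ is a differentiable function such that $\tilde h'(x)=k\int_0^x\widetilde\Phi(\xi)\,d\xi$, $x>0$. Then the function $v(x,t)=\tilde h(x)$, $x\ge0$, $t\ge0$, is a solution to Problem $\widetilde{\mathrm P}$ independent of the temporal variable $t$. 2. Let $\lambda,\eta,\delta\in\mathbb{R}\setminus\{0\}$ and $\sigma\in\mathbb{R}$, and let $\widetilde F$ be given, for $V\in\mathbb{R}$, $t>0$, by one of: $\widetilde F(V,t)=\nu V$ with $\nu\in\mathbb{R}\setminus\{0\}$; $\widetilde F(V,t)=f_1(t)+f_2(t)V$ with $f_1,f_2\in L^1_{loc}(\mathbb{R}^+)$; or $\widetilde F(V,t)=V^nf(t)$ with $n<1$, $f\in L^1_{loc}(\mathbb{R}^+)$, $f>0$ and $\lambda,\delta,\eta>0$. Let $\tilde h(x)=\eta\widetilde X(x)$ and $\widetilde\Phi(x)=\lambda\widetilde X(x)$, $x>0$, where $$\widetilde X(x)=\begin{cases}\delta\cosh(\sqrt\sigma\,x)&\text{if }\sigma>0,\\ \delta\cos(\sqrt{|\sigma|}\,x)&\text{if }\sigma<0,\\ \delta&\text{if }\sigma=0.\end{cases}$$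 Then the function $v(x,t)=\widetilde X(x)\widetilde T(t)$, $x\ge0$, $t\ge0$, is a solution with separated variables to Problem $\widetilde{\mathrm P}$, where $\widetilde T$ is the solution of the initial value problem $\dot{\widetilde T}(t)-\sigma\widetilde T(t)=-\lambda\widetilde F(\delta\widetilde T(t),t)$, $t>0$, $\widetilde T(0)=\eta$. 3. Let $\widetilde F(V,t)=\nu V$, $V\in\mathbb{R}$, $t>0$, for some $\nu>0$, let $\tilde h(x)=\tilde\eta x^l$, $x>0$, for some $\tilde\eta\in\mathbb{R}\setminus\{0\}$ and $l\ge0$, and let $\widetilde\Phi$ be given by one of $$\widetilde\varphi_1(x)=\tilde\lambda,\qquad\widetilde\varphi_2(x)=-\tilde\mu\cosh(\tilde\lambda x)\qquad\text{or}\qquad\widetilde\varphi_3(x)=-\tilde\mu\cos(\tilde\lambda x),\qquad x>0,$$ for some $\tilde\lambda>0$ and $\tilde\mu>0$. Then the function $v(x,t)=u_x(x,t)$, $x\ge0$, $t\ge0$, is a solution to Problem $\widetilde{\mathrm P}$, where $u$ is given by the formula for $u^{(i)}$ in the context if $\widetilde\Phi=\widetilde\varphi_i$, $i=1,2,3$.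
   Context: Problem $\widetilde{\mathrm P}$: find $v=v(x,t)$ with $v_t(x,t)-v_{xx}(x,t)=-\widetilde\Phi(x)\widetilde F(v(0,t),t)$ for $x>0$, $t>0$; $v(x,0)=\tilde h(x)$ for $x>0$; $v_x(0,t)=\tilde g(t)$ for $t>0$. Formulas for $u$ in item 3. Here $u$ is the solution of $u_t-u_{xx}=-\Phi(x)\,\nu u_x(0,t)$ ($x,t>0$), $u(x,0)=h(x)$, $u(0,t)=0$, with $h(x)=\eta x^m$ and $\Phi$ equal to $\varphi_1(x)=\lambda x$, $\varphi_2(x)=-\mu\sinh(\lambda x)$ or $\varphi_3(x)=-\mu\sin(\lambda x)$, where $h'=\tilde h$ and $\Phi'=\widetilde\Phi$; that is, $m=l+1$, $\eta=\tilde\eta/m$, $\lambda=\tilde\lambda$, $\mu=\tilde\mu/\tilde\lambda$. The closed formulas below are written for $m=2p+1$, $p\in\mathbb{N}_0$, with $\sigma=\lambda+\nu\mu\ne0$ for $u^{(2)}$ and $\delta=\lambda-\nu\mu\ne0$ for $u^{(3)}$ (these $\lambda,\eta,\sigma,\delta$ are unrelated to those in item 2). Put $$c=\frac{2^{m-1}m\eta}{\sqrt\pi}\Gamma\Big(\frac m2\Big),\qquad u_0(x,t)=\frac{\eta}{\sqrt\pi}\sum_{k=0}^p\binom m{2k}\Gamma\Big(\frac{2k+1}2\Big)(4t)^kx^{m-2k},$$ where $\Gamma$ is the Gamma function. Then $$u^{(1)}(x,t)=u_0(x,t)-\nu\varphi_1(x)\int_0^tV_1(\tau)\,d\tau,$$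 $$u^{(2)}(x,t)=u_0(x,t)-\nu\varphi_2(x)e^{\lambda^2t}\int_0^tV_2(\tau)e^{-\lambda^2\tau}\,d\tau,$$ $$u^{(3)}(x,t)=u_0(x,t)-\nu\varphi_3(x)e^{-\lambda^2t}\int_0^tV_3(\tau)e^{\lambda^2\tau}\,d\tau,$$ where $V_i(t)=u^{(i)}_x(0,t)$ is given by $$V_1(t)=p_{1,m}(t)-c_{1,m}e^{-\nu\lambda t},\quad V_2(t)=p_{2,m}(t)+c_{2,m}e^{\lambda\sigma t},\quad V_3(t)=p_{3,m}(t)+c_{3,m}e^{-\lambda\delta t},$$ $$c_{1,m}=(-1)^{p-1}\frac{c\,p!}{(\nu\lambda)^p},\quad c_{2,m}=\frac{c\nu\mu\,p!}{\sigma(\lambda\sigma)^p},\quad c_{3,m}=(-1)^{p-1}\frac{c\nu\mu\,p!}{\delta(\lambda\delta)^p}.$$ The polynomials are: - $p_{1,1}=0$; $p_{1,3}=c_{1,3}$; $p_{1,5}(t)=-c_{1,5}(\nu\lambda t-1)$; for $m\ge7$, $p_{1,m}(t)=c_{1,m}\Big(\sum_{k=1}^{p-1}\frac{(-\nu\lambda)^k}{k!}t^k+(-1)^{p-1}\Big)$. - $p_{2,1}=\frac{\eta\lambda}\sigma$; $p_{2,3}(t)=c_{2,3}\big(\frac{\lambda^2\sigma}{\nu\mu}t-1\big)$; $p_{2,5}(t)=c_{2,5}\big(\frac{\lambda^3\sigma^2}{2\nu\mu}t^2-\lambda\sigma t-1\big)$; for $m\ge7$, $p_{2,m}(t)=\frac{c\lambda}\sigma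 t^p-c_{2,m}\Big(\sum_{k=1}^{p-1}\frac{(\lambda\sigma)^k}{k!}t^k+1\Big)$. - $p_{3,1}=\frac{\eta\lambda}\delta$; $p_{3,3}(t)=c_{3,3}\big(\frac{\lambda^2\delta}{\nu\mu}t-1\big)$; $p_{3,5}(t)=-c_{3,5}\big(\frac{\lambda^3\delta^2}{2\nu\mu}t^2-\lambda\delta t+1\big)$; for $m\ge7$, $p_{3,m}(t)=\frac{c\lambda}\delta t^p-c_{3,m}\Big(\sum_{k=1}^{p-1}\frac{(-\lambda\delta)^k}{k!}t^k+1\Big)$.
   Formalization: In item 3 the constant term (-1)^{p-1} in p_{1,m}, m≥7, is corrected to 1 (the printed value gives V_1(0)≠0 for even p, so u_x would not solve the problem); l=2p, σ≠0, δ≠0 as in the context's closed formulas. *)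

(* Defs.v *)
From HB Require Import structures.
From mathcomp Require Import all_boot all_order all_algebra.
From mathcomp Require Import all_classical all_reals all_analysis.

Set Implicit Arguments.
Unset Strict Implicit.
Unset Printing Implicit Defensive.

Import Order.TTheory GRing.Theory Num.Theory.
Import numFieldNormedType.Exports.

Local Open Scope classical_set_scope.
Local Open Scope ring_scope.

Section Calculus.
Context {R : realType}.

Definition cosh (x : R) : R := (expR x + expR (- x)) / 2.

Definition sinh (x : R) : R := (expR x - expR (- x)) / 2.

Definition Gamma (s : R) : R :=
  \int[lebesgue_measure]_(x in `]0, +oo[) (x `^ (s - 1) * expR (- x)).

Definition abs_continuous (a b : R) (f : R -> R) : Prop :=
  forall e : R, 0 < e -> exists2 d : R, 0 < d &
    forall (n : nat) (l r : 'I_n -> R),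
      (forall i, [/\ a <= l i, l i <= r i & r i <= b]) ->
      trivIset [set: 'I_n] (fun i => `]l i, r i[%classic) ->
      \sum_(i < n) (r i - l i) < d ->
      \sum_(i < n) `|f (r i) - f (l i)| < e.

End Calculus.

(* The problem
     v_t - v_xx = - Phi(x) F(v(0, t), t)   for x > 0, t > 0,
     v(x, 0) = h(x)                        for x > 0,
     v_x(0, t) = g(t)                      for t > 0.
   Functions of x and t are total on R; only their values for x >= 0 and t >= 0
   matter.  Accordingly the derivative at x = 0 is one-sided.
   When the data are only locally integrable the differential equations cannot
   be expected to hold pointwise, hence two notions of solution: a classical
   one, and a Caratheodory one where the equation holds almost everywhere and
   the functions being differentiated are locally absolutely continuous. *)
Section Problem.
Context {R : realType}.
Implicit Types (Phi h g : R -> R) (F v : R -> R -> R).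

Definition heat_equation_at Phi F v (x t : R) : Prop :=
  [/\ derivable (v x) t 1,
      derivable (derive1 (v^~ t)) x 1 &
      derive1 (v x) t - derive1 (derive1 (v^~ t)) x = - Phi x * F (v 0 t) t].

Definition initial_boundary_conditions h g v : Prop :=
  [/\ {within [set z : R * R | 0 <= z.1 /\ 0 <= z.2],
         continuous (fun z : R * R => v z.1 z.2)},
      forall x t, 0 < x -> 0 < t -> derivable (v^~ t) x 1,
      forall x, 0 < x -> v x 0 = h x &
      forall t, 0 < t -> (v x t - v 0 t) / x @[x --> 0^'+] --> g t].

Definition classical_solution Phi F h g v : Prop :=
  initial_boundary_conditions h g v /\
  forall x t, 0 < x -> 0 < t -> heat_equation_at Phi F v x t.

Definition caratheodory_solution Phi F h g v : Prop :=
  [/\ initial_boundary_conditions h g v,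
      forall x b, 0 <= x -> 0 < b -> abs_continuous 0 b (v x),
      forall t a b, 0 < t -> 0 < a -> a < b ->
        abs_continuous a b (derive1 (v^~ t)) &
      {ae (@lebesgue_measure R \x @lebesgue_measure R)%E,
        forall z : R * R, 0 < z.1 -> 0 < z.2 ->
          heat_equation_at Phi F v z.1 z.2}].

Definition time_independent v : Prop :=
  forall x t t', 0 <= x -> 0 <= t -> 0 <= t' -> v x t = v x t'.

Definition separated_variables v : Prop :=
  exists X T : R -> R, forall x t, 0 <= x -> 0 <= t -> v x t = X x * T t.

End Problem.

(* Separated variables: the profile X, and the initial value problem
     T' - sigma T = - lambda F(delta T, t) for t > 0,   T(0) = eta. *)
Section Separated.
Context {R : realType}.
Variables (sigma delta : R).

Definition profile (x : R) : R :=
  if 0 < sigma then delta * cosh (Num.sqrt sigma * x)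
  else if sigma < 0 then delta * cos (Num.sqrt `|sigma| * x)
  else delta.

Variables (lambda eta : R) (F : R -> R -> R).

Definition ode_at (T : R -> R) (t : R) : Prop :=
  derivable T t 1 /\ derive1 T t - sigma * T t = - lambda * F (delta * T t) t.

Definition classical_ivp_solution (T : R -> R) : Prop :=
  [/\ T 0 = eta, T t @[t --> 0^'+] --> T 0 & forall t, 0 < t -> ode_at T t].

Definition caratheodory_ivp_solution (T : R -> R) : Prop :=
  [/\ T 0 = eta,
      forall b, 0 < b -> abs_continuous 0 b T &
      {ae @lebesgue_measure R, forall t : R, 0 < t -> ode_at T t}].

End Separated.

(* Explicit solutions u of u_t - u_xx = - Phi(x) nu u_x(0, t), u(x, 0) =
   eta x^m, u(0, t) = 0, for odd m = 2p + 1 and Phi(x) equal to lambda x (u1),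
   - mu sinh(lambda x) (u2) or - mu sin(lambda x) (u3).  In each case
   V i (t) is the flux u_x(0, t). *)
Section Explicit.
Context {R : realType}.
Variables (nu lambda mu eta : R) (p : nat).

Let m : nat := p.*2.+1.
Let sigma : R := lambda + nu * mu.
Let delta : R := lambda - nu * mu.
Let sgn : R := (-1) ^ (p%:Z - 1).

Definition c : R :=
  2 ^+ m.-1 * m%:R * eta / Num.sqrt pi * Gamma (m%:R / 2).

Definition u0 (x t : R) : R :=
  eta / Num.sqrt pi *
  \sum_(0 <= k < p.+1)
    'C(m, k.*2)%:R * Gamma (k.*2.+1%:R / 2) * (4 * t) ^+ k * x ^+ (m - k.*2).

Definition phi1 (x : R) : R := lambda * x.
Definition phi2 (x : R) : R := - mu * sinh (lambda * x).
Definition phi3 (x : R) : R := - mu * sin (lambda * x).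

Definition c1 : R := sgn * (c * p`!%:R / (nu * lambda) ^+ p).
Definition c2 : R := c * nu * mu * p`!%:R / (sigma * (lambda * sigma) ^+ p).
Definition c3 : R :=
  sgn * (c * nu * mu * p`!%:R / (delta * (lambda * delta) ^+ p)).

(* The term 1 for p >= 3 is sometimes written (-1)^(p-1), which is a misprint
   when p is even: the compatibility V1 0 = 0 (p >= 1) and the equation
   V1' + nu lambda V1 = c p t^(p-1) force it to be 1. *)
Definition p1 (t : R) : R :=
  match p with
  | 0 => 0
  | 1 => c1
  | 2 => - c1 * (nu * lambda * t - 1)
  | _ => c1 * (\sum_(1 <= k < p) (- (nu * lambda)) ^+ k / k`!%:R * t ^+ k + 1)
  end.

Definition p2 (t : R) : R :=
  match p with
  | 0 => eta * lambda / sigma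
  | 1 => c2 * (lambda ^+ 2 * sigma / (nu * mu) * t - 1)
  | 2 => c2 * (lambda ^+ 3 * sigma ^+ 2 / (2 * nu * mu) * t ^+ 2
               - lambda * sigma * t - 1)
  | _ => c * lambda / sigma * t ^+ p
         - c2 * (\sum_(1 <= k < p) (lambda * sigma) ^+ k / k`!%:R * t ^+ k + 1)
  end.

Definition p3 (t : R) : R :=
  match p with
  | 0 => eta * lambda / delta
  | 1 => c3 * (lambda ^+ 2 * delta / (nu * mu) * t - 1)
  | 2 => - c3 * (lambda ^+ 3 * delta ^+ 2 / (2 * nu * mu) * t ^+ 2
                 - lambda * delta * t + 1)
  | _ => c * lambda / delta * t ^+ p
         - c3 * (\sum_(1 <= k < p) (- (lambda * delta)) ^+ k / k`!%:R * t ^+ k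
                 + 1)
  end.

Definition V1 (t : R) : R := p1 t - c1 * expR (- (nu * lambda * t)).
Definition V2 (t : R) : R := p2 t + c2 * expR (lambda * sigma * t).
Definition V3 (t : R) : R := p3 t + c3 * expR (- (lambda * delta * t)).

Definition u1 (x t : R) : R :=
  u0 x t - nu * phi1 x * \int[lebesgue_measure]_(tau in `[0, t]) V1 tau.

Definition u2 (x t : R) : R :=
  u0 x t - nu * phi2 x * expR (lambda ^+ 2 * t) *
    \int[lebesgue_measure]_(tau in `[0, t])
      (V2 tau * expR (- (lambda ^+ 2 * tau))).

Definition u3 (x t : R) : R :=
  u0 x t - nu * phi3 x * expR (- (lambda ^+ 2 * t)) *
    \int[lebesgue_measure]_(tau in `[0, t])
      (V3 tau * expR (lambda ^+ 2 * tau)).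

End Explicit.

(* Main.v *)
(* In items 1 and 2 the equation factorizes. A time-independent solution needs
   [h'' = k Phi], which holds where the primitive of [Phi] is differentiable,
   hence almost everywhere; its absolute continuity is that of the integral.
   With separated variables, [X'' = sigma X] and [X'(0) = 0] reduce the problem
   to the equation for [T].

   In item 3, [Gamma (k + 1/2) = sqrt pi (2k)! / (4^k k!)] turns the space
   derivative of [u0] into a multiple [A] of the heat polynomial
   [sum_k t^k / k! * x^(2p - 2k) / (2p - 2k)!], whose value at [x = 0] is
   [c t^p], while [-nu Phi] is [b] times an even profile [X] with [X 0 = 1] and
   [X'' = kappa X]. All three fluxes are the function [V] with
   [V' = (b + kappa) V + c p t^(p-1) - kappa c t^p] and [V 0 = c 0^p]. That
   equation says that [(V - c t^p) / b] is the exponentially weighted integral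
   of [V] occurring in [u], so the solution is
   [A * heat polynomial + X(x) (V(t) - c t^p)], with trace [V] at [x = 0]. *)

Require Import Defs.
From HB Require Import structures.
From mathcomp Require Import all_boot all_order all_algebra.
From mathcomp Require Import all_classical all_reals all_analysis.
From mathcomp Require Import measurable_realfun ring lra.

Set Implicit Arguments.
Unset Strict Implicit.
Unset Printing Implicit Defensive.

Import Order.TTheory GRing.Theory Num.Theory.
Import numFieldNormedType.Exports.

Local Open Scope classical_set_scope.
Local Open Scope ring_scope.

(** * Derivatives of real functions *)

Section Pointwise.
Context {R : realType}.
Implicit Types (f g : R -> R) (x a b k : R).

Lemma fderiv_cst k x : is_derive x 1 (fun _ : R => k) 0.
Proof. exact: is_derive_cst. Qed.

Lemma fderiv_id x : is_derive x 1 (fun y : R => y) 1.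
Proof. exact: is_derive_id. Qed.

Lemma fderivD f g x a b : is_derive x 1 f a -> is_derive x 1 g b ->
  is_derive x 1 (fun y => f y + g y) (a + b).
Proof. by move=> fa gb; exact: is_deriveD. Qed.

Lemma fderivN f x a : is_derive x 1 f a -> is_derive x 1 (fun y => - f y) (- a).
Proof. by move=> fa; exact: is_deriveN. Qed.

Lemma fderivM f g x a b : is_derive x 1 f a -> is_derive x 1 g b ->
  is_derive x 1 (fun y => f y * g y) (f x * b + g x * a).
Proof. by move=> fa gb; exact: is_deriveM. Qed.

Lemma fderiv_comp f g x a b : is_derive (g x) 1 f a -> is_derive x 1 g b ->
  is_derive x 1 (fun y => f (g y)) (a * b).
Proof. by move=> fa gb; exact: (is_derive1_comp fa gb). Qed.

Lemma fderivX n x : is_derive x 1 (fun y : R => y ^+ n) (n%:R * x ^+ n.-1).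
Proof.
have := @is_deriveX R _ id n x 1 1 (@is_derive_id _ _ x 1).
by rewrite exprfctE /GRing.scale/= mulr1.
Qed.

Lemma fderiv_sum n (F dF : nat -> R -> R) x :
  (forall i, (i < n)%N -> is_derive x 1 (F i) (dF i x)) ->
  is_derive x 1 (fun y => \sum_(0 <= i < n) F i y) (\sum_(0 <= i < n) dF i x).
Proof.
elim: n => [|n IH] dF_.
  by rewrite big_geq//; under eq_fun do rewrite big_geq//; exact: fderiv_cst.
rewrite big_nat_recr//=; under eq_fun do rewrite big_nat_recr//=.
by apply: fderivD; [apply: IH => i /ltnW; exact: dF_|exact: dF_].
Qed.

End Pointwise.

Ltac deriv :=
  repeat first [ exact: fderiv_cst | exact: fderiv_id | exact: fderivX
               | exact: is_derive_expR | exact: is_derive_sin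
               | exact: is_derive_cos
               | eapply fderivD | eapply fderivN | eapply fderivM
               | eapply (@fderiv_comp _ expR) | eapply (@fderiv_comp _ sin)
               | eapply (@fderiv_comp _ cos)
               | eapply (@fderiv_comp _ (fun y => y ^+ _)) ].

Section Profile.
Context {R : realType}.
Implicit Types (sigma delta x lambda : R).

Definition dprofile sigma delta x : R :=
  if 0 < sigma then delta * Num.sqrt sigma * sinh (Num.sqrt sigma * x)
  else if sigma < 0 then
    - delta * Num.sqrt `|sigma| * sin (Num.sqrt `|sigma| * x)
  else 0.

Lemma is_derive_profile sigma delta x :
  is_derive x 1 (profile sigma delta) (dprofile sigma delta x).
Proof.
rewrite /dprofile (_ : profile _ _ = fun y => profile sigma delta y)//.
rewrite /profile /cosh /sinh.
case: ltP => _; last case: ltP => _.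
- by eapply is_derive_eq; [deriv|rewrite /=; ring].
- by eapply is_derive_eq; [deriv|rewrite /=; ring].
- exact: fderiv_cst.
Qed.

Lemma is_derive_dprofile sigma delta x :
  is_derive x 1 (dprofile sigma delta) (sigma * profile sigma delta x).
Proof.
rewrite /profile (_ : dprofile _ _ = fun y => dprofile sigma delta y)//.
rewrite /dprofile /cosh /sinh.
case: ltP => s0; last case: ltP => s1.
- have : sigma = Num.sqrt sigma ^+ 2 by rewrite sqr_sqrtr// ltW.
  move: (Num.sqrt sigma) => s sE.
  by eapply is_derive_eq; [deriv|rewrite /= sE; field].
- have : sigma = - Num.sqrt `|sigma| ^+ 2.
    by rewrite sqr_sqrtr// ltr0_norm// opprK.
  move: (Num.sqrt _) => s sE.
  by eapply is_derive_eq; [deriv|rewrite /= sE; ring].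
- have -> : sigma = 0 by apply/eqP; rewrite eq_le s0 s1.
  by rewrite mul0r; exact: fderiv_cst.
Qed.

Lemma profile_at0 sigma delta : profile sigma delta 0 = delta.
Proof.
rewrite /profile /cosh; do ![case: ifP => // _].
- by rewrite mulr0 oppr0 expR0; field.
- by rewrite mulr0 cos0 mulr1.
Qed.

Lemma dprofile_at0 sigma delta : dprofile sigma delta 0 = 0.
Proof.
rewrite /dprofile /sinh; do ![case: ifP => // _].
- by rewrite mulr0 oppr0 expR0 subrr mul0r mulr0.
- by rewrite mulr0 sin0 mulr0.
Qed.

Lemma profile0 delta x : profile 0 delta x = delta.
Proof. by rewrite /profile ltxx. Qed.

Lemma profile_sqr lambda delta x : 0 < lambda ->
  profile (lambda ^+ 2) delta x = delta * cosh (lambda * x).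
Proof.
by move=> l0; rewrite /profile exprn_gt0// sqrtr_sqr gtr0_norm.
Qed.

Lemma profileN_sqr lambda delta x : 0 < lambda ->
  profile (- lambda ^+ 2) delta x = delta * cos (lambda * x).
Proof.
move=> l0; have l20 : 0 < lambda ^+ 2 by rewrite exprn_gt0.
rewrite /profile oppr_gt0 oppr_lt0 l20 (lt_gtF l20) normrN gtr0_norm//.
by rewrite sqrtr_sqr gtr0_norm.
Qed.

Lemma is_derive_continuous (f df : R -> R) :
  (forall x, is_derive x 1 f (df x)) -> continuous f.
Proof.
by move=> fE x; apply: differentiable_continuous; apply/derivable1_diffP; case: (fE x).
Qed.

Lemma continuous_profile sigma delta : continuous (profile sigma delta).
Proof. exact: (is_derive_continuous (is_derive_profile sigma delta)). Qed.

End Profile.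

(** * Solutions of the problem *)

Section Solutions.
Context {R : realType}.
Implicit Types (Phi h g X T : R -> R) (F v w : R -> R -> R).

Lemma near_pos_is_derive (f f' : R -> R) (x df : R) : 0 < x ->
  (forall y : R, 0 < y -> f y = f' y) -> is_derive x 1 f' df -> is_derive x 1 f df.
Proof.
move=> x0 ff'; apply: near_eq_is_derive.
by near=> y; apply/esym/ff'; near: y; exact: lt_nbhsr.
Unshelve. all: by end_near. Qed.

Lemma heat_equation_at_eq Phi F v w (wx : R -> R) (wxx wt x t : R) :
  0 < x -> 0 < t -> (forall x t : R, 0 <= x -> 0 <= t -> v x t = w x t) ->
  (forall y : R, 0 < y -> is_derive y 1 (w^~ t) (wx y)) ->
  is_derive x 1 wx wxx -> is_derive t 1 (w x) wt ->
  wt - wxx = - Phi x * F (w 0 t) t -> heat_equation_at Phi F v x t.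
Proof.
move=> x0 t0 vw dx dxx dt eqn.
have dt' : is_derive t 1 (v x) wt.
  by apply: (@near_pos_is_derive (v x) (w x)) => // s s0; rewrite vw// ltW.
have dxx' : is_derive x 1 (derive1 (v^~ t)) wxx.
  apply: (@near_pos_is_derive (derive1 (v^~ t)) wx) => // y y0.
  have [_ <-] : is_derive y 1 (v^~ t) (wx y).
    apply: (@near_pos_is_derive (v^~ t) (w^~ t)) => // [z z0|]; last exact: dx.
    by rewrite vw// ltW.
  by rewrite derive1E.
split; [by case: dt'|by case: dxx'|].
by rewrite !derive1E !derive_val eqn vw// ltW.
Qed.

Lemma continuous_max0 T :
  {within `[0, +oo[, continuous T} -> continuous (fun t : R => T (Num.max 0 t)).
Proof.
move=> /subspace_continuousP Tc t.
have /Tc : `[0, +oo[%classic (Num.max 0 t) by rewrite /= in_itv/= andbT le_max lexx.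
apply: (@cvg_comp _ _ _ (fun s => Num.max 0 s) T) => P.
rewrite /within/= => nP.
have maxc : {for t, continuous (fun s : R => Num.max 0 s)}.
  by apply: (@continuous_max R _ (fun _ => 0) id); [exact: cvg_cst|exact: cvg_id].
apply: (filterS (P := fun s => `[0, +oo[%classic (Num.max 0 s) -> P (Num.max 0 s)));
  last exact: maxc _ nP.
by move=> s; apply; rewrite /= in_itv/= andbT le_max lexx.
Qed.

Lemma continuous_separated X T : continuous X -> continuous T ->
  continuous (fun z : R * R => X z.1 * T z.2).
Proof.
move=> Xc Tc z; apply: cvgM.
- exact: (@continuous_comp _ _ _ fst X z cvg_fst (Xc _)).
- exact: (@continuous_comp _ _ _ snd T z cvg_snd (Tc _)).
Qed.

Lemma within_quadrant_continuous v w :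
  (forall x t : R, 0 <= x -> 0 <= t -> v x t = w x t) ->
  continuous (fun z : R * R => w z.1 z.2) ->
  {within [set z : R * R | 0 <= z.1 /\ 0 <= z.2],
    continuous (fun z : R * R => v z.1 z.2)}.
Proof.
move=> vw wc; apply: (@subspace_eq_continuous _ _ _ (fun z => w z.1 z.2)).
  by move=> [x t]; rewrite inE => -[/= x0 t0]; exact/esym/vw.
exact: continuous_subspaceT.
Qed.

Lemma is_derive0_cvg (f : R -> R) (l : R) : is_derive (0 : R) 1 f l ->
  (f x - f 0) / x @[x --> 0^'+] --> l.
Proof.
move=> [/cvg_ex[l' fl'] <-].
have -> : 'D_1 f 0 = l' by exact/cvg_lim.
have {}fl' := cvg_dnbhs_at_right fl'.
apply: cvg_trans fl'; apply: near_eq_cvg; near=> x.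
by rewrite /= /GRing.scale/= mulr1 addr0 mulrC.
Unshelve. all: by end_near. Qed.

End Solutions.

Section AbsolutelyContinuous.
Context {R : realType}.
Implicit Types (f g df T : R -> R) (a b k : R).

Lemma eq_abs_continuous a b f g : (forall x, a <= x <= b -> f x = g x) ->
  abs_continuous a b f -> abs_continuous a b g.
Proof.
move=> fg fac e e0; have [d d0 fd] := fac e e0; exists d => // n l r lr tI lrd.
rewrite (eq_bigr (fun i => `|f (r i) - f (l i)|)); first exact: fd.
move=> i _; have [al lri rb] := lr i.
by rewrite !fg// ?al ?rb ?andbT ?(le_trans lri)// (le_trans al).
Qed.

Lemma lipschitz_abs_continuous a b (M : R) f :
  (forall x y, a <= x -> x <= y -> y <= b -> `|f y - f x| <= M * (y - x)) ->
  abs_continuous a b f.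
Proof.
move=> fM e e0; pose M' := Num.max M 1.
have M'0 : 0 < M' by rewrite lt_max ltr01 orbT.
exists (e / M'); first exact: divr_gt0.
move=> n l r lr tI; rewrite ltr_pdivlMr//; apply: le_lt_trans.
rewrite mulr_suml; apply: ler_sum => i _; have [al lri rb] := lr i.
rewrite mulrC (le_trans (fM _ _ _ _ _))// ler_wpM2r ?subr_ge0//.
by rewrite le_max lexx.
Qed.

Lemma abs_continuousZ a b k f :
  abs_continuous a b f -> abs_continuous a b (fun x => k * f x).
Proof.
move=> fac e e0; pose k' := `|k| + 1.
have k'0 : 0 < k' by rewrite ltr_wpDl.
have [d d0 fd] := fac (e / k') (divr_gt0 e0 k'0); exists d => // n l r lr tI lrd.
have := fd n l r lr tI lrd; rewrite ltr_pdivlMr// mulr_suml; apply: le_lt_trans.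
apply: ler_sum => i _; rewrite -mulrBr normrM mulrC ler_wpM2l//.
by rewrite lerDl.
Qed.

Lemma abs_continuous_within T : (forall b, 0 < b -> abs_continuous 0 b T) ->
  {within `[0, +oo[, continuous T}.
Proof.
move=> Tac; apply/subspace_continuousP => x; rewrite /= in_itv/= andbT => x0.
have x10 : 0 < x + 1 by rewrite ltr_wpDl.
apply/cvgrPdist_lt => e e0; have [d d0 Td] := Tac _ x10 _ e0.
rewrite near_withinE; near=> y; rewrite /= in_itv/= andbT => y0.
have xy1 : y <= x + 1.
  suff /ltW : y < x + 1 by [].
  by near: y; apply: lt_nbhsl; rewrite ltrDl.
have xyd : `|x - y| < d by near: y; exact: cvgr_dist_lt.
have := Td 1%N (fun _ => Num.min x y) (fun _ => Num.max x y).
rewrite !big_ord1; case: (leP x y) xyd => xy xyd.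
  rewrite distrC; apply => //.
    by move=> i j _ _ _; rewrite [i]ord1 [j]ord1.
  by rewrite -[ltLHS]ger0_norm ?subr_ge0// distrC.
apply => //.
- by move=> _; split=> //; [exact: ltW|rewrite lerDl].
- by move=> i j _ _ _; rewrite [i]ord1 [j]ord1.
- by rewrite -[ltLHS]ger0_norm ?subr_ge0// ltW.
Unshelve. all: by end_near. Qed.

Lemma is_derive_abs_continuous f df a b : a < b ->
  (forall x : R, is_derive x 1 f (df x)) -> continuous df -> abs_continuous a b f.
Proof.
move=> ab fdf dfc.
have [c _ dfM] : exists2 c, c \in `[a, b]%R &
    forall t, t \in `[a, b]%R -> `|df t| <= `|df c|.
  apply: EVT_max; first exact: ltW.
  by apply: continuous_subspaceT => x; apply: cvg_norm; exact: dfc.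
apply: (@lipschitz_abs_continuous _ _ `|df c|) => x y ax xy yb.
have [|z] := MVT_segment xy (fun z _ => fdf z).
  exact: continuous_subspaceT (is_derive_continuous fdf).
rewrite in_itv/= => /andP[xz zy] ->; rewrite normrM [X in _ * X]ger0_norm ?subr_ge0//.
by rewrite ler_wpM2r ?subr_ge0// dfM// in_itv/= (le_trans ax)//= (le_trans zy).
Qed.

End AbsolutelyContinuous.

Section AlmostEverywhere.
Context {R : realType}.
Let mu := @lebesgue_measure R.

Lemma ae_product_fst (P : R -> Prop) : {ae mu, forall x, P x} ->
  {ae (mu \x mu)%E, forall z : R * R, P z.1}.
Proof.
move=> [N [mN N0 PN]]; exists (N `*` setT); split.
- exact: measurableX.
- by transitivity (mu N * mu setT)%E; [exact: product_measure1E|rewrite N0 mul0e].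
- by move=> z /= /PN.
Qed.

Lemma ae_product_snd (P : R -> Prop) : {ae mu, forall x, P x} ->
  {ae (mu \x mu)%E, forall z : R * R, P z.2}.
Proof.
move=> [N [mN N0 PN]]; exists (setT `*` N); split.
- exact: measurableX.
- by transitivity (mu setT * mu N)%E; [exact: product_measure1E|rewrite N0 mule0].
- by move=> z /= /PN.
Qed.

End AlmostEverywhere.

Section SeparatedSolutions.
Context {R : realType}.
Variables (Phi h g : R -> R) (F v : R -> R -> R).
Hypothesis g0 : forall t : R, 0 < t -> g t = 0.

Lemma separated_initial_boundary (X T : R -> R) :
  {within `[0, +oo[, continuous X} -> {within `[0, +oo[, continuous T} ->
  (forall x : R, 0 < x -> derivable X x 1) ->
  (X x - X 0) / x @[x --> 0^'+] --> (0 : R) ->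
  (forall x, 0 < x -> h x = X x * T 0) ->
  (forall x t, 0 <= x -> 0 <= t -> v x t = X x * T t) ->
  initial_boundary_conditions h g v.
Proof.
move=> Xc Tc dX X0 hX vE; split.
- pose w (x t : R) : R := X (Num.max 0 x) * T (Num.max 0 t).
  apply: (@within_quadrant_continuous _ v w).
    by move=> x t x0 t0; rewrite /w !max_r// vE.
  exact: continuous_separated (continuous_max0 Xc) (continuous_max0 Tc).
- move=> x t x0 t0; suff [] : is_derive x 1 (v^~ t) (T t * 'D_1 X x) by [].
  apply: (@near_pos_is_derive _ _ (fun y => T t * X y)) => // [y y0|].
    by rewrite vE ?ltW// mulrC.
  eapply is_derive_eq.
    by eapply fderivM; [exact: fderiv_cst|exact: derivableP (dX _ x0)].
  by rewrite /= mulr0 addr0.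
- by move=> x x0; rewrite hX// vE// ltW.
- move=> t t0; rewrite g0// -[X in _ --> X](mulr0 (T t)).
  have Tl : T t * ((X x - X 0) / x) @[x --> 0^'+] --> T t * 0.
    by apply: cvgM X0; exact: cvg_cst.
  apply: cvg_trans Tl; apply: near_eq_cvg.
  near=> x; have x0 : 0 < x by [].
  by rewrite /= !vE//= ?(ltW x0) ?(ltW t0)//; ring.
Unshelve. all: by end_near. Qed.

Section Exponential.
Variables (lambda eta delta sigma : R) (T : R -> R).
Hypothesis hE : forall x, 0 < x -> h x = eta * profile sigma delta x.
Hypothesis PhiE : forall x, 0 < x -> Phi x = lambda * profile sigma delta x.
Hypothesis vE : forall x t, 0 <= x -> 0 <= t -> v x t = profile sigma delta x * T t.

Lemma profile_initial_boundary : T 0 = eta -> {within `[0, +oo[, continuous T} ->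
  initial_boundary_conditions h g v.
Proof.
move=> T0 Tc; apply: (separated_initial_boundary _ Tc _ _ _ vE).
- apply: continuous_subspaceT; exact: continuous_profile.
- by move=> x _; case: (is_derive_profile sigma delta x).
- apply: is_derive0_cvg; have := is_derive_profile sigma delta 0.
  by rewrite dprofile_at0.
- by move=> x x0; rewrite hE// T0 mulrC.
Qed.

Lemma profile_heat_equation (x t : R) : 0 < x -> 0 < t ->
  ode_at sigma delta lambda F T t -> heat_equation_at Phi F v x t.
Proof.
move=> x0 t0 [dT odeT].
apply: (@heat_equation_at_eq _ _ _ _ (fun x t => profile sigma delta x * T t)
  (fun y => dprofile sigma delta y * T t) (sigma * profile sigma delta x * T t)
  (profile sigma delta x * derive1 T t)) => //.
- move=> y _; eapply is_derive_eq.
    by eapply fderivM; [exact: is_derive_profile|exact: fderiv_cst].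
  by rewrite /= mulr0 add0r mulrC.
- eapply is_derive_eq.
    by eapply fderivM; [exact: is_derive_dprofile|exact: fderiv_cst].
  by rewrite /= mulr0 add0r mulrC.
- eapply is_derive_eq.
    by eapply fderivM; [exact: fderiv_cst|exact: derivableP dT].
  by rewrite /= mulr0 addr0 derive1E.
- rewrite PhiE// profile_at0.
  transitivity (profile sigma delta x * (derive1 T t - sigma * T t)); first by ring.
  by rewrite odeT; ring.
Qed.

Lemma profile_classical_solution : classical_ivp_solution sigma delta lambda eta F T ->
  classical_solution Phi F h g v.
Proof.
move=> [T0 Tc0 odeT]; split.
  apply: profile_initial_boundary => //; apply/continuous_within_itvcyP; split=> //.
  move=> t; rewrite in_itv/= andbT => /odeT[dT _].
  exact/differentiable_continuous/derivable1_diffP.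
by move=> x t x0 t0; apply: profile_heat_equation => //; exact: odeT.
Qed.

Lemma profile_caratheodory_solution :
  caratheodory_ivp_solution sigma delta lambda eta F T ->
  caratheodory_solution Phi F h g v.
Proof.
move=> [T0 Tac odeT]; split.
- by apply: profile_initial_boundary => //; exact: abs_continuous_within.
- move=> x b x0 b0.
  apply: (@eq_abs_continuous _ _ _ (fun t => profile sigma delta x * T t)).
    by move=> t /andP[t0 _]; rewrite vE.
  exact/abs_continuousZ/Tac.
- move=> t a b t0 a0 ab.
  apply: (@eq_abs_continuous _ _ _ (fun x => T t * dprofile sigma delta x)).
    move=> x /andP[ax _]; have x0 : 0 < x by exact: lt_le_trans ax.
    rewrite derive1E.
    suff [_ ->] : is_derive x 1 (v^~ t) (T t * dprofile sigma delta x) by [].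
    apply: (@near_pos_is_derive _ _ (fun x => T t * profile sigma delta x)) => //.
      by move=> y y0; rewrite vE ?ltW// mulrC.
    eapply is_derive_eq.
      by eapply fderivM; [exact: fderiv_cst|exact: is_derive_profile].
    by rewrite /= mulr0 addr0.
  apply: abs_continuousZ; apply: is_derive_abs_continuous ab _ _.
    exact: is_derive_dprofile.
  move=> x; apply: cvgM; first exact: cvg_cst.
  exact: continuous_profile.
- have := ae_product_snd odeT; apply: filterS.
    exact: (ae_filter_ringOfSetsType (lebesgue_measure \x lebesgue_measure)%E).
  move=> -[x t] /= ode x0 t0.
  by apply: profile_heat_equation => //; exact: ode.
Qed.

End Exponential.

End SeparatedSolutions.

Section Primitive.
Context {R : realType}.
Notation mu := (@lebesgue_measure R).
Implicit Types (f : R -> R).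

Lemma small_Rintegral f (D : set R) (e : R) : measurable D ->
  mu.-integrable D (EFin \o f) -> 0 < e ->
  exists2 d : R, 0 < d & forall A, measurable A -> A `<=` D ->
    (mu A < d%:E)%E -> \int[mu]_(x in A) `|f x| < e.
Proof.
move=> mD intf e0.
have intfD : mu.-integrable setT (EFin \o (f \_ D)).
  by rewrite -restrict_EFin; apply/integrable_restrict => //=; rewrite setTI.
have [d [d0 small]] := integral_normr_continuous intfD e0.
exists d => // A mA AD Ad; rewrite (le_lt_trans _ (small A mA Ad))//.
rewrite le_eqVlt; apply/orP; left; apply/eqP; apply: eq_Rintegral => x.
by rewrite inE => Ax; rewrite patchE mem_set//; exact: AD.
Qed.

Section primitive.
Variable f : R -> R.
Hypothesis intf : forall x : R, 0 < x -> mu.-integrable `]0, x] (EFin \o f).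
Let I (x : R) := \int[mu]_(xi in `]0, x]) f xi.

Lemma primitive_cvg0 : I x @[x --> 0^'+] --> (0 : R).
Proof.
apply/cvgrPdist_lt => e e0.
have [d d0 small] := small_Rintegral (measurable_itv _) (intf ltr01) e0.
near=> x.
have x0 : 0 < x by [].
have x1 : x <= 1 by near: x; exact: nbhs_right_le.
have xd : x < d by near: x; exact: nbhs_right_lt.
rewrite sub0r normrN (le_lt_trans (le_normr_Rintegral _ (intf x0)))//.
apply: small => //.
  by apply: subset_itvl; rewrite bnd_simp.
by rewrite lebesgue_measure_itv/= lte_fin x0 sube0 lte_fin.
Unshelve. all: by end_near. Qed.

Lemma primitive_abs_continuous (a b : R) : 0 < a -> a < b -> abs_continuous a b I.
Proof.
move=> a0 ab e e0; have b0 := lt_trans a0 ab.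
have [d d0 small] := small_Rintegral (measurable_itv _) (intf b0) e0.
exists d => // n l r lr tI lrd.
pose J (i : 'I_n) : set R := `]l i, r i[%classic.
have JD i : J i `<=` `]0, b]%classic.
  have [al _ rb] := lr i; move=> x; rewrite /J /= !in_itv/= => /andP[lx xr].
  by rewrite (lt_trans a0 (le_lt_trans al lx)) (le_trans (ltW xr) rb).
pose D := \big[setU/set0]_(i < n) J i.
have DD : D `<=` `]0, b]%classic by move=> x; rewrite /D -bigcup_seq => -[i _]; exact: JD.
have mD : measurable D by apply: bigsetU_measurable => i _; exact: measurable_itv.
have muD : (mu D < d%:E)%E.
  rewrite measure_bigsetU_ord//=; last by move=> i; exact: measurable_itv.
  rewrite (eq_bigr (fun i => (r i - l i)%:E)) ?sumEFin ?lte_fin// => i _.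
  have [_ lri _] := lr i; rewrite /J lebesgue_measure_itv/= lte_fin.
  by case: ltP => // rl; rewrite (@le_anti _ _ (l i) (r i)) ?subrr// lri rl.
have := small D mD DD muD; apply: le_lt_trans.
have intD : mu.-integrable D (EFin \o f).
  apply: (@integrableS _ _ _ mu `]0, b] D) => //; exact: intf.
have Jf i : mu.-integrable (J i) (EFin \o f).
  apply: (@integrableS _ _ _ mu `]0, b] (J i)); last exact: intf.
  - exact: measurable_itv.
  - exact: measurable_itv.
  - exact: JD.
have norm_fin (A : set R) : measurable A -> mu.-integrable A (EFin \o f) ->
    (\int[mu]_(x in A) `|f x|%:E)%E \is a fin_num.
  move=> mA intA; refine (@integrable_fin_num _ _ _ mu A mA (fun x => `|f x|%:E) _).
  exact (integrable_norm intA).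
rewrite [leRHS](_ : _ = \sum_(i < n) \int[mu]_(x in J i) `|f x|); last first.
  apply: EFin_inj; rewrite -sumEFin /Rintegral fineK; last exact: norm_fin.
  rewrite ge0_integral_bigsetU//.
  - by apply: eq_bigr => i _; rewrite fineK//; apply: norm_fin;
      [exact: measurable_itv|exact: Jf].
  - by move=> i; exact: measurable_itv.
  - exact: index_enum_uniq.
  - by apply: sub_trivIset tI.
  - apply/measurable_EFinP; apply: measurableT_comp => //.
    by apply/measurable_EFinP; exact: measurable_int intD.
apply: ler_sum => i _; have [al lri rb] := lr i.
have r0 : 0 < r i by rewrite (lt_le_trans a0)// (le_trans al).
rewrite /I Rintegral_itvB ?bnd_simp//; last 2 first.
  exact: intf.
  by rewrite ltW// (lt_le_trans a0).
rewrite -Rintegral_itv_bndo_bndc; last exact: Jf.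
refine (@le_normr_Rintegral _ _ _ mu (J i) f _ (Jf i)); exact: measurable_itv.
Qed.

Lemma is_derive_primitive_ae :
  locally_integrable `]0, +oo[ f ->
  {ae mu, forall x : R, 0 < x -> is_derive x 1 I (f x)}.
Proof.
move=> [mf _ lf]; pose f0 := f \_ `]0, +oo[.
have restrE (x : R) : `]0, x] `&` `]0, +oo[ = `]0, x]%classic :> set R.
  by apply: setIidl; apply: subset_itvl; rewrite bnd_simp.
have intf0 (x : R) : mu.-integrable `]0, x] (EFin \o f0).
  rewrite -restrict_EFin; apply/integrable_restrict => //; rewrite restrE.
  have [x0|x0] := ltP 0 x; first exact: intf.
  by rewrite set_itv_ge ?bnd_simp -?leNgt//; exact: integrable_set0.
have locf0 : locally_integrable setT f0.
  split; [by apply/(measurable_restrictT _ _).1|exact: openT|] => K _ cK.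
  have [M [_ KM]] := compact_bounded cK.
  pose B := Num.max 1 (M + 1).
  have B0 : 0 < B by rewrite lt_max ltr01.
  have KB x : K x -> `|x| <= B.
    by apply: KM; rewrite lt_max ltrDl ltr01 orbT.
  rewrite (_ : (fun x => `|f0 x|%:E) = ((fun x => `|f x|%:E) \_ `]0, +oo[)); last first.
    by apply/funext => x; rewrite /f0 !patchE; case: ifP => // _; rewrite normr0.
  rewrite -integral_mkcondr.
  apply: (@le_lt_trans _ _ (\int[mu]_(x in `]0%R, B]) `|f x|%:E)%E).
    apply: ge0_subset_integral => //=.
    - by apply: measurableI => //; exact: compact_measurable.
    - apply/measurable_EFinP; apply: measurableT_comp => //.
      by apply/measurable_EFinP; exact: measurable_int (intf B0).
    - move=> x [Kx]; rewrite /= !in_itv/= andbT => -> /=.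
      by rewrite (le_trans (ler_norm x))// KB.
  by have /integrableP[_] := intf B0.
have := FTC1 intf0 locf0; apply: filterS.
  exact: (ae_filter_ringOfSetsType mu).
move=> x FTCx x0; have [//|dF F'E] := FTCx.
have F'x : is_derive x 1 (fun y => \int[mu]_(t in `]0, y]) f0 t) (f x).
  by split=> //; rewrite -derive1E F'E /f0 patchE mem_set// /= in_itv/= x0.
apply: near_pos_is_derive F'x => // y y0; apply: eq_Rintegral => z.
by rewrite inE/= in_itv/= => /andP[z0 _]; rewrite /f0 patchE mem_set//= in_itv/= z0.
Qed.

Lemma is_derive_primitive (x : R) : 0 < x -> {for x, continuous f} ->
  is_derive x 1 I (f x).
Proof.
move=> x0 fx.
have xu : x < x + 1 by rewrite ltrDl.
have [dI I'E] := continuous_FTC1 xu (intf (lt_trans x0 xu)) x0 fx.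
by split; rewrite // -derive1E.
Qed.

End primitive.
End Primitive.

Section StationarySolutions.
Context {R : realType}.
Variables (Phi h g : R -> R) (F v : R -> R -> R).
Hypothesis g0 : forall t : R, 0 < t -> g t = 0.
Hypothesis vE : forall x t : R, 0 <= x -> 0 <= t -> v x t = h x.

Lemma stationary_time_independent : time_independent v.
Proof. by move=> x t t' x0 t0 t'0; rewrite !vE. Qed.

Lemma constant_classical_solution (a : R) :
  (forall V t, 0 < t -> F V t = 0) -> (forall x, 0 <= x -> h x = a) ->
  classical_solution Phi F h g v.
Proof.
move=> F0 ha; split.
- apply: (@separated_initial_boundary _ _ _ _ g0 (fun _ => a) (fun _ => 1)).
  + by apply: continuous_subspaceT => ?; exact: cvg_cst.
  + by apply: continuous_subspaceT => ?; exact: cvg_cst.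
  + by move=> x _; exact: derivable_cst.
  + by under eq_fun do rewrite subrr mul0r; exact: cvg_cst.
  + by move=> x x0; rewrite mulr1 ha// ltW.
  + by move=> x t x0 t0; rewrite mulr1 vE// ha.
- move=> x t x0 t0.
  apply: (@heat_equation_at_eq _ _ _ _ (fun _ _ => a) (fun _ => 0) 0 0) => //.
  + by move=> y s y0 s0; rewrite vE// ha.
  + by move=> y _; exact: (fderiv_cst a).
  + by rewrite F0// subrr mulr0.
Qed.

Section integrated_source.
Variable k : R.
Hypothesis Fk : forall V t, 0 < t -> F V t = k.
Hypothesis intPhi : forall x : R, 0 < x ->
  (@lebesgue_measure R).-integrable `]0, x] (EFin \o Phi).
Hypothesis h0 : h x @[x --> 0^'+] --> h 0.
Hypothesis dh : forall x : R, 0 < x -> derivable h x 1.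
Let I (x : R) := \int[lebesgue_measure]_(xi in `]0, x]) Phi xi.
Hypothesis h'E : forall x : R, 0 < x -> derive1 h x = k * I x.

Let is_derive_h (x : R) : 0 < x -> is_derive x 1 h (k * I x).
Proof. by move=> x0; split; [exact: dh|rewrite -derive1E h'E]. Qed.

Let h_within : {within `[0, +oo[, continuous h}.
Proof.
apply/continuous_within_itvcyP; split=> // x; rewrite in_itv/= andbT => x0.
exact/differentiable_continuous/derivable1_diffP/dh.
Qed.

Let h_slope : (h x - h 0) / x @[x --> 0^'+] --> (0 : R).
Proof.
have kI : k * I x @[x --> 0^'+] --> (0 : R).
  rewrite -[X in _ --> X](mulr0 k).
  by apply: cvgM; [exact: cvg_cst|exact: (primitive_cvg0 intPhi)].
apply/cvgrPdist_lt => e e0.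
move/cvgrPdist_lt : kI => /(_ e e0)[d /= d0 kId].
near=> x; have x0 : 0 < x by [].
have [||c] := @MVT _ h (fun x => k * I x) 0 x x0.
- by move=> y; rewrite in_itv/= => /andP[y0 _]; exact: is_derive_h.
- apply: continuous_subspaceW h_within => y /=.
  by rewrite !in_itv/= andbT => /andP[].
rewrite in_itv/= subr0 => /andP[c0 cx] ->; rewrite mulfK ?gt_eqF//.
apply: kId => //=; rewrite sub0r normrN gtr0_norm// (lt_trans cx)//.
Unshelve. all: by end_near. Qed.

Let initial_boundary : initial_boundary_conditions h g v.
Proof.
apply: (@separated_initial_boundary _ _ _ _ g0 h (fun _ => 1)) => //.
- by apply: continuous_subspaceT => ?; exact: cvg_cst.
- by move=> x _; rewrite mulr1.
- by move=> x t x0 t0; rewrite mulr1 vE.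
Qed.

Let heat_equation (x t : R) : 0 < x -> 0 < t -> is_derive x 1 I (Phi x) ->
  heat_equation_at Phi F v x t.
Proof.
move=> x0 t0 I'x.
apply: (@heat_equation_at_eq _ _ _ _ (fun y _ => h y) (fun y => k * I y)
  (k * Phi x) 0) => //.
by rewrite Fk//; ring.
Qed.

Lemma stationary_caratheodory_solution : locally_integrable `]0, +oo[ Phi ->
  caratheodory_solution Phi F h g v.
Proof.
move=> locPhi; split=> //.
- move=> x b x0 b0.
  apply: (@eq_abs_continuous _ _ _ (fun _ => h x)).
    by move=> t /andP[t0 _]; rewrite vE.
  by apply: (@lipschitz_abs_continuous _ _ _ 0) => ? ? _ _ _; rewrite subrr normr0 mul0r.
- move=> t a b t0 a0 ab.
  apply: (@eq_abs_continuous _ _ _ (fun x => k * I x)).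
    move=> x /andP[ax _]; have x0 : 0 < x by exact: lt_le_trans ax.
    rewrite derive1E.
    suff [_ ->] : is_derive x 1 (v^~ t) (k * I x) by [].
    apply: (@near_pos_is_derive _ _ h) => //; last exact: is_derive_h.
    by move=> y y0; rewrite vE ?ltW.
  exact/abs_continuousZ/primitive_abs_continuous.
- have := ae_product_fst (is_derive_primitive_ae intPhi locPhi).
  apply: filterS.
    exact: (ae_filter_ringOfSetsType (lebesgue_measure \x lebesgue_measure)%E).
  by move=> -[x t] /= I' x0 t0; apply: heat_equation => //; exact: I'.
Qed.

Lemma stationary_classical_solution :
  (forall x : R, 0 < x -> {for x, continuous Phi}) ->
  classical_solution Phi F h g v.
Proof.
move=> Phic; split=> // x t x0 t0; apply: heat_equation => //.
by apply: is_derive_primitive => //; exact: Phic.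
Qed.

End integrated_source.
End StationarySolutions.

(** * The Gamma function at half-integers *)

Section HalfIntegerGamma.
Context {R : realType}.
Notation mu := (@lebesgue_measure R).

Lemma ge0_integral_positive_ray (f G : R -> R) (a l : R) :
  (forall x, 0 < x -> 0 <= f x) ->
  (forall x : R, 0 < x -> {for x, continuous f}) ->
  (forall x : R, 0 < x -> is_derive x 1 G (f x)) ->
  G x @[x --> 0^'+] --> a -> G x @[x --> +oo] --> l ->
  (\int[mu]_(x in `]0%R, +oo[) (f x)%:E = (l - a)%:E)%E.
Proof.
move=> f0 fc dG Ga Gl.
pose J (n : nat) : set R := `[n.+1%:R^-1, +oo[%classic.
have JE : `]0, +oo[%classic = \bigcup_n J n.
  apply/seteqP; split => x; rewrite /= ?in_itv/= ?andbT.
    move=> x0; exists (Num.truncn x^-1) => //; rewrite /J /= in_itv/= andbT.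
    by rewrite invf_ple ?posrE// ltW// truncnS_gt.
  by move=> [n _]; rewrite /J /= in_itv/= andbT; apply: lt_le_trans; rewrite invr_gt0.
have Jint n : (\int[mu]_(x in J n) (f x)%:E = (l - G n.+1%:R^-1)%:E)%E.
  have n0 : 0 < n.+1%:R^-1 :> R by rewrite invr_gt0.
  rewrite EFinB; apply: ge0_continuous_FTC2y => //.
  - by move=> x nx; apply: f0; exact: lt_le_trans nx.
  - apply/continuous_within_itvcyP; split.
      move=> x; rewrite in_itv/= andbT => nx; apply: fc; exact: lt_trans nx.
    exact/cvg_at_right_filter/fc.
  - by move=> x nx; case: (dG x (lt_trans n0 nx)).
  - apply/cvg_at_right_filter/differentiable_continuous/derivable1_diffP.
    by case: (dG _ n0).
  - move=> x; rewrite in_itv/= andbT => nx.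
    by rewrite derive1E; case: (dG x (lt_trans n0 nx)).
have mf : measurable_fun (`]0, +oo[%classic : set R) f.
  apply: open_continuous_measurable_fun; first exact: interval_open.
  by move=> x; rewrite inE/= in_itv/= andbT; exact: fc.
have fJ n : measurable_fun (J n) (fun x => (f x)%:E).
  apply/measurable_EFinP; apply: measurable_funS mf => //.
  by move=> x Jx; rewrite JE; exists n.
have cvgJ : (\int[mu]_(x in J n) (f x)%:E @[n --> \oo] -->
             \int[mu]_(x in `]0%R, +oo[) (f x)%:E)%E.
  rewrite JE; apply: ge0_nondecreasing_set_cvg_integral => //.
  - apply/nondecreasing_seqP => n; rewrite subsetEset; apply: subset_itvr.
    by rewrite bnd_simp lef_pV2 ?posrE// ler_nat.
  - by move=> n; exact: measurable_itv.
  - move=> n x; rewrite /J /= in_itv/= andbT => nx; rewrite lee_fin f0//.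
    by apply: lt_le_trans nx; rewrite invr_gt0.
rewrite -(cvg_lim _ cvgJ)//; apply/cvg_lim => //.
under eq_fun do rewrite Jint.
apply: cvg_EFin; first exact: nearW.
apply: cvgB; first exact: cvg_cst.
move/cvg_at_rightP : Ga; apply; split; last exact: cvg_harmonic.
by move=> n; rewrite invr_gt0.
Qed.

Let tail (k : nat) (x : R) : R := x ^+ k * Num.sqrt x * expR (- x).

Let is_derive_tail k (x : R) : 0 < x ->
  is_derive x 1 (tail k)
    ((k%:R + 2^-1) * (x ^+ k / Num.sqrt x * expR (- x))
     - x ^+ k.+1 / Num.sqrt x * expR (- x)).
Proof.
move=> x0; have s0 : Num.sqrt x != 0 by rewrite gt_eqF// sqrtr_gt0.
have xE : x = Num.sqrt x ^+ 2 by rewrite sqr_sqrtr// ltW.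
eapply is_derive_eq.
  eapply fderivM; first eapply fderivM.
  - exact: fderivX.
  - exact: is_derive1_sqrt.
  - by deriv.
rewrite /=.
have kE : k%:R * x ^+ k.-1 = k%:R * x ^+ k / x :> R.
  by case: k => [|k]; rewrite ?mul0r//= exprSr; field; rewrite gt_eqF.
rewrite kE exprSr; move: (x ^+ k) => y.
have -> : k%:R * y / x = k%:R * y / (Num.sqrt x ^+ 2) by rewrite -xE.
rewrite [in y * x]xE.
by move: (Num.sqrt x) (expR (- x)) s0 => s e s0; field.
Qed.

Let tail_cvg0 k : tail k x @[x --> 0^'+] --> (0 : R).
Proof.
apply: cvg_at_right_filter.
rewrite [X in _ --> X](_ : 0 = 0 ^+ k * Num.sqrt 0 * expR (- 0)); last first.
  by rewrite sqrtr0 mulr0 mul0r.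
apply: cvgM; first apply: cvgM.
- exact: exprn_continuous.
- exact: sqrt_continuous.
- by apply: continuous_cvg; [exact: continuous_expR|exact: cvgN].
Qed.

Let tail_cvgy k : tail k x @[x --> +oo] --> (0 : R).
Proof.
apply: (@squeeze_cvgr _ _ _ _ (fun _ => 0) (fun x => k.+2`!%:R * x^-1)).
- near=> x; have x1 : 1 <= x by [].
  have x0 : 0 < x by exact: lt_le_trans x1.
  rewrite !mulr_ge0 ?exprn_ge0 ?sqrtr_ge0 ?expR_ge0 ?(ltW x0)//=.
  have sx : Num.sqrt x <= x.
    rewrite -[leRHS]ger0_norm ?(ltW x0)// -sqrtr_sqr ler_wsqrtr// expr2.
    by rewrite ler_peMr ?(ltW x0).
  apply: (@le_trans _ _ (x ^+ k.+1 * expR (- x))).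
    by rewrite ler_wpM2r ?expR_ge0// exprSr ler_wpM2l// exprn_ge0// ltW.
  rewrite expRN ler_pdivrMr ?expR_gt0// mulrAC ler_pdivlMr// -exprSr.
  have := expR_ge1Dxn k.+1 (ltW x0).
  rewrite -ler_pdivrMl ?ltr0n ?fact_gt0// mulrC; apply: le_trans.
  by rewrite lerDr.
- exact: cvg_cst.
- rewrite -[X in _ --> X](mulr0 k.+2`!%:R); apply: cvgM; first exact: cvg_cst.
  by apply/gtr0_cvgV0; [exact: nbhs_pinfty_gt|exact: cvg_id].
Unshelve. all: by end_near. Qed.

Let half_gauss (y : R) : R := parameterized_integral mu 0 y gauss_fun.

Let integrable_gauss (y : R) : mu.-integrable `[0, y] (EFin \o gauss_fun).
Proof.
apply: continuous_compact_integrable; first exact: segment_compact.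
by apply: continuous_subspaceT; exact: continuous_gauss_fun.
Qed.

Let is_derive_half_gauss (y : R) : 0 < y -> is_derive y 1 half_gauss (gauss_fun y).
Proof.
move=> y0; have yu : y < y + 1 by rewrite ltrDl.
have [dP PE] := continuous_FTC1_closed yu (integrable_gauss _) y0
  (@continuous_gauss_fun R y).
by split; rewrite // -derive1E.
Qed.

Let half_gauss_cvgy : half_gauss y @[y --> +oo] --> Num.sqrt pi / 2.
Proof.
have sqr_cvg := @gauss_integral_proof.cvg_integral0_gauss_sqr R.
have : Num.sqrt (half_gauss x ^+ 2) @[x --> +oo] --> Num.sqrt (pi / 4).
  by apply: continuous_cvg sqr_cvg; exact: sqrt_continuous.
rewrite sqrtrM ?pi_ge0// sqrtrV// (_ : 4 = 2 ^+ 2); last by rewrite -natrX.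
rewrite sqrtr_sqr ger0_norm//; apply: cvg_trans; apply: near_eq_cvg.
near=> y; rewrite sqrtr_sqr ger0_norm//.
exact: gauss_integral_proof.integral0_gauss_ge0.
Unshelve. all: by end_near. Qed.

Let sqrt_cvgy : Num.sqrt x @[x --> +oo] --> (+oo : set_system R).
Proof.
apply/cvgryPge => A; near=> x.
have Ax : (Num.max 0 A) ^+ 2 <= x by [].
apply: (@le_trans _ _ (Num.max 0 A)); first by rewrite le_max lexx orbT.
have A0 : 0 <= Num.max 0 A by rewrite le_max lexx.
by rewrite -[leLHS](ger0_norm A0) -sqrtr_sqr ler_wsqrtr.
Unshelve. all: by end_near. Qed.

Let integrand (k : nat) (x : R) : R := x ^+ k / Num.sqrt x * expR (- x).

(* Integration by parts lowers the exponent; carried out on primitives it needs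
   no improper boundary terms. *)
Fixpoint gamma_primitive (k : nat) (x : R) : R :=
  if k is j.+1 then (j%:R + 2^-1) * gamma_primitive j x - tail j x
  else 2 * half_gauss (Num.sqrt x).

Let is_derive_gamma_primitive k (x : R) : 0 < x ->
  is_derive x 1 (gamma_primitive k) (integrand k x).
Proof.
move=> x0; have s0 : 0 < Num.sqrt x by rewrite sqrtr_gt0.
elim: k => [|k IH]; rewrite /gamma_primitive -/gamma_primitive.
  eapply is_derive_eq.
    eapply fderivM; first exact: fderiv_cst.
    eapply (@fderiv_comp _ half_gauss); first exact: is_derive_half_gauss.
    exact: is_derive1_sqrt.
  rewrite /integrand /gauss_fun /= sqr_sqrtr ?(ltW x0)//.
  by move: (Num.sqrt x) s0 => s s0; field; rewrite gt_eqF.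
eapply is_derive_eq.
  eapply fderivD; first by eapply fderivM; [exact: fderiv_cst|exact: IH].
  eapply fderivN; exact: is_derive_tail.
by rewrite /integrand /=; ring.
Qed.

Let gamma_primitive_cvg0 k : gamma_primitive k x @[x --> 0^'+] --> (0 : R).
Proof.
elim: k => [|k IH] /=.
  rewrite -[X in _ --> X](mulr0 2); apply: cvgM; first exact: cvg_cst.
  apply: cvg_at_right_filter.
  apply: (@cvg_comp _ _ _ Num.sqrt half_gauss _ (nbhs 0)).
    by have := @sqrt_continuous R 0; rewrite /continuous_at sqrtr0.
  exact: parameterized_integral_cvg_left ltr01 (integrable_gauss _).
rewrite -[X in _ --> X](subr0 0) -{2}(mulr0 (k%:R + 2^-1)).
by apply: cvgB; [apply: cvgM => //; exact: cvg_cst|exact: tail_cvg0].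
Qed.

Let gamma_primitive_cvgy k : gamma_primitive k x @[x --> +oo] -->
  (Num.sqrt pi * (k.*2`!%:R / (4 ^+ k * k`!%:R)) : R).
Proof.
elim: k => [|k IH] /=.
  rewrite [X in _ --> X](_ : _ = 2 * (Num.sqrt pi / 2)); last first.
    by rewrite !fact0 expr0; field.
  apply: cvgM; first exact: cvg_cst.
  exact: cvg_comp sqrt_cvgy half_gauss_cvgy.
rewrite [X in _ --> X](_ : _ = (k%:R + 2^-1) *
    (Num.sqrt pi * (k.*2`!%:R / (4 ^+ k * k`!%:R))) - 0); last first.
  rewrite doubleS !factS exprS !natrM -!natr1 -[k.*2]muln2 natrM.
  have k0 : k`!%:R != 0 :> R by rewrite pnatr_eq0 -lt0n fact_gt0.
  field; rewrite k0 (natr1 k) pnatr_eq0 andbT /=.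
  by apply/expf_neq0/lt0r_neq0; lra.
by apply: cvgB; [apply: cvgM => //; exact: cvg_cst|exact: tail_cvgy].
Qed.

Lemma Gamma_half_odd k :
  Gamma (k.*2.+1%:R / 2) = Num.sqrt pi * (k.*2`!%:R / (4 ^+ k * k`!%:R)) :> R.
Proof.
have -> : Gamma (k.*2.+1%:R / 2) = \int[mu]_(x in `]0%R, +oo[) integrand k x.
  apply: eq_Rintegral => x; rewrite inE/= in_itv/= andbT => x0; congr (_ * _).
  rewrite (_ : _ - 1 = k%:R - 2^-1); last by rewrite -natr1 -muln2 natrM; field.
  rewrite powRB; last by rewrite (gt_eqF x0) implybT.
  by rewrite powR_mulrn ?powR12_sqrt// ltW.
set L := (X in _ = X); suff intL :
    (\int[mu]_(x in `]0%R, +oo[) (integrand k x)%:E = (L - 0)%:E)%E.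
  by rewrite /Rintegral intL subr0.
apply: (@ge0_integral_positive_ray _ (gamma_primitive k)) => //.
- by move=> x x0; rewrite mulr_ge0 ?expR_ge0// divr_ge0 ?sqrtr_ge0// exprn_ge0// ltW.
- move=> x x0; apply: cvgM; first apply: cvgM.
  + exact: exprn_continuous.
  + by apply: cvgV; [rewrite gt_eqF// sqrtr_gt0|exact: sqrt_continuous].
  + by apply: continuous_cvg; [exact: continuous_expR|exact: cvgN].
- by move=> x; exact: is_derive_gamma_primitive.
Qed.

End HalfIntegerGamma.

(** * Explicit solutions for power data *)

Section HeatPolynomials.
Context {R : realType}.
Implicit Types (x t : R).

Definition scaled_monomial (k : nat) (x : R) : R := x ^+ k / k`!%:R.
Local Notation e := scaled_monomial.

Lemma is_derive_scaled_monomial k x : (0 < k)%N -> is_derive x 1 (e k) (e k.-1 x).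
Proof.
case: k => // k _.
eapply is_derive_eq; first by eapply fderivM; [exact: fderivX|exact: fderiv_cst].
rewrite /e /= mulr0 add0r factS natrM.
have k0 : k`!%:R != 0 :> R by rewrite pnatr_eq0 -lt0n fact_gt0.
by field; rewrite k0 (addrC 1) (natr1 k) pnatr_eq0.
Qed.

Lemma scaled_monomial0 k : e k 0 = (k == 0%N)%:R.
Proof. by rewrite /e expr0n; case: k => [|k]; rewrite ?divr1// mul0r. Qed.

Lemma continuous_scaled_monomial k : continuous (e k).
Proof. by move=> x; apply: cvgM; [exact: exprn_continuous|exact: cvg_cst]. Qed.

Definition heat_poly (p : nat) x t : R :=
  \sum_(0 <= k < p.+1) e k t * e (p - k).*2 x.

Definition dx_heat_poly (p : nat) x t : R :=
  \sum_(0 <= k < p) e k t * e (p - k).*2.-1 x.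

(* Both the time derivative and the second space derivative of [heat_poly p]. *)
Definition dt_heat_poly (p : nat) x t : R :=
  if p is q.+1 then heat_poly q x t else 0.

Lemma is_derive_heat_poly_x p x t :
  is_derive x 1 (heat_poly p ^~ t) (dx_heat_poly p x t).
Proof.
rewrite /heat_poly /dx_heat_poly.
under eq_fun do rewrite big_nat_recr//= subnn double0.
eapply is_derive_eq.
  eapply fderivD.
    apply: (@fderiv_sum _ _ _ (fun k x => e k t * e (p - k).*2.-1 x)) => k kp.
    eapply is_derive_eq.
      eapply fderivM; first exact: fderiv_cst.
      by apply: is_derive_scaled_monomial; rewrite double_gt0 subn_gt0.
    by rewrite /= mulr0 addr0.
  eapply fderivM; first exact: fderiv_cst.
  by rewrite /e/=; under eq_fun do rewrite expr0; exact: fderiv_cst.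
by rewrite /= !mulr0 !addr0.
Qed.

Lemma is_derive_dx_heat_poly p x t :
  is_derive x 1 (dx_heat_poly p ^~ t) (dt_heat_poly p x t).
Proof.
rewrite /dx_heat_poly; eapply is_derive_eq.
  apply: (@fderiv_sum _ _ _ (fun k x => e k t * e (p - k).*2.-2 x)) => k kp.
  eapply is_derive_eq.
    eapply fderivM; first exact: fderiv_cst.
    apply: is_derive_scaled_monomial.
    by rewrite -ltnS prednK ?double_gt0 ?subn_gt0// -(doubleS 0) leq_double subn_gt0.
  by rewrite /= mulr0 addr0.
case: p => [|p] /=; first by rewrite big_geq.
apply: eq_big_nat => k /andP[_ kp].
by rewrite subSn// doubleS.
Qed.

Lemma is_derive_heat_poly_t p x t :
  is_derive t 1 (heat_poly p x) (dt_heat_poly p x t).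
Proof.
rewrite (_ : heat_poly p x = fun t => heat_poly p x t)// /heat_poly.
under eq_fun do rewrite big_nat_recl//=.
eapply is_derive_eq.
  eapply fderivD.
    eapply fderivM; last exact: fderiv_cst.
    by rewrite /e/=; under eq_fun do rewrite expr0; exact: fderiv_cst.
  apply: (@fderiv_sum _ _ _ (fun k t => e k t * e (p - k.+1).*2 x)) => k kp.
  eapply is_derive_eq.
    by eapply fderivM; [exact: is_derive_scaled_monomial|exact: fderiv_cst].
  by rewrite /= mulr0 add0r mulrC.
rewrite /= !mulr0 !add0r; case: p => [|p] /=; first by rewrite big_geq.
by apply: eq_big_nat => k _; rewrite subSS.
Qed.

Lemma heat_poly_x0 p t : heat_poly p 0 t = e p t.
Proof.
rewrite /heat_poly big_nat_recr//= subnn double0 scaled_monomial0 mulr1.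
rewrite big_nat big1 ?add0r// => k /andP[_ kp].
by rewrite scaled_monomial0 double_eq0 subn_eq0 leqNgt kp mulr0.
Qed.

Lemma dx_heat_poly_x0 p t : dx_heat_poly p 0 t = 0.
Proof.
rewrite /dx_heat_poly big_nat big1// => k /andP[_ kp].
rewrite scaled_monomial0; case: (p - k)%N (subn_gt0 k p) => [|j] //=.
  by rewrite kp.
by rewrite mulr0.
Qed.

Lemma heat_poly_t0 p x : heat_poly p x 0 = e p.*2 x.
Proof.
rewrite /heat_poly big_nat_recl//= scaled_monomial0 mul1r subn0.
by rewrite big1 ?addr0// => k _; rewrite scaled_monomial0 mul0r.
Qed.

Lemma continuous_heat_poly p : continuous (fun z : R * R => heat_poly p z.1 z.2).
Proof.
rewrite /heat_poly; elim: p.+1 => [|n IH].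
  by under eq_fun do rewrite big_geq//; move=> z; exact: cvg_cst.
under eq_fun => z do rewrite big_nat_recr//= [e n _ * _]mulrC.
move=> z; apply: cvgD; first exact: IH.
exact: (continuous_separated (@continuous_scaled_monomial (p - n).*2)
  (@continuous_scaled_monomial n)).
Qed.

End HeatPolynomials.

Section ExplicitSolutions.
Context {R : realType}.
Local Notation e := (@scaled_monomial R).

Section Coefficients.
Variables (eta : R) (p : nat).

Let sqrtpi_neq0 : Num.sqrt pi != 0 :> R.
Proof. by rewrite gt_eqF// sqrtr_gt0 pi_gt0. Qed.

Let fact_neq0 n : n`!%:R != 0 :> R.
Proof. by rewrite pnatr_eq0 -lt0n fact_gt0. Qed.

Lemma c_factE : c eta p = eta * p.*2.+1`!%:R / p`!%:R.
Proof.
rewrite /c Gamma_half_odd factS natrM /= -muln2 mulnC exprM.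
have -> : (2 : R) ^+ 2 = 4 by rewrite -natrX.
have q0 : (4 : R) ^+ p != 0 by rewrite expf_neq0// pnatr_eq0.
move: sqrtpi_neq0 (fact_neq0 p); rewrite mul2n.
move: (4 ^+ p) q0 (Num.sqrt pi) => q q0 s s0 f0.
by field; rewrite q0 s0 f0.
Qed.

Lemma u0_monomials (x t : R) :
  u0 eta p x t =
  eta * p.*2.+1`!%:R * \sum_(0 <= k < p.+1) e k t * e (p - k).*2.+1 x.
Proof.
rewrite /u0 !mulr_sumr; apply: eq_big_nat => k; rewrite ltnS => /= kp.
have km : (k.*2 <= p.*2.+1)%N by rewrite leqW// leq_double.
rewrite -(bin_fact km) !natrM Gamma_half_odd subSn ?leq_double// -doubleB.
rewrite exprMn /scaled_monomial.
have q0 : (4 : R) ^+ k != 0 by rewrite expf_neq0// pnatr_eq0.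
move: sqrtpi_neq0 (fact_neq0 k) (fact_neq0 (p - k).*2.+1).
move: (4 ^+ k) q0 (Num.sqrt pi) => q q0 s s0 f0 f1.
by field; rewrite q0 s0 f0 f1.
Qed.

Lemma is_derive_u0 (x t : R) :
  is_derive x 1 (u0 eta p ^~ t) (eta * p.*2.+1`!%:R * heat_poly p x t).
Proof.
under eq_fun do rewrite u0_monomials.
eapply is_derive_eq.
  eapply fderivM; first exact: fderiv_cst.
  apply: (@fderiv_sum _ _ _ (fun k x => e k t * e (p - k).*2 x)) => k kp.
  eapply is_derive_eq.
    by eapply fderivM; [exact: fderiv_cst|exact: is_derive_scaled_monomial].
  by rewrite /= mulr0 addr0.
by rewrite /= mulr0 addr0.
Qed.

End Coefficients.

Section Flux.
Variables (kappa b c : R) (p : nat).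
Let r : R := b + kappa.
Hypothesis r0 : r != 0.

Definition exp_sum (x : R) : R := \sum_(0 <= k < p) e k x.

(* Solves [V' = r V + c p t^(p-1) - kappa c t^p], [V 0 = c 0^p]. *)
Definition flux (t : R) : R :=
  kappa * c / r * t ^+ p + c * b * p`!%:R / r ^+ p.+1 * (expR (r * t) - exp_sum (r * t)).

Lemma flux0 : flux 0 = c * 0 ^+ p.
Proof.
rewrite /flux /exp_sum mulr0 expR0; case: p => [|q].
  by rewrite big_geq// fact0 expr0 expr1 /r; field; exact: r0.
rewrite big_nat_recl// scaled_monomial0 big1 => [|k _]; last by rewrite scaled_monomial0.
by rewrite addr0 subrr expr0n/= !mulr0 addr0.
Qed.

Lemma is_derive_flux (t : R) :
  is_derive t 1 (fun t => flux t - c * t ^+ p)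
    (kappa * (flux t - c * t ^+ p) + b * flux t).
Proof.
rewrite /flux /exp_sum; case: p => [|q].
  under eq_fun do rewrite big_geq// subr0.
  rewrite big_geq//.
  eapply is_derive_eq; first by deriv.
  by rewrite /= !expr0 fact0 expr1 /r; field; exact: r0.
have dE : is_derive t 1 (fun t => \sum_(0 <= k < q.+1) e k (r * t))
    (r * \sum_(0 <= k < q) e k (r * t)).
  under eq_fun do rewrite big_nat_recl//.
  eapply is_derive_eq.
    eapply fderivD.
      by rewrite /scaled_monomial; under eq_fun do rewrite expr0; exact: fderiv_cst.
    apply: (@fderiv_sum _ _ _ (fun k t => r * e k (r * t))) => k kp.
    eapply is_derive_eq.
      eapply (@fderiv_comp _ (e k.+1)); first exact: is_derive_scaled_monomial.
      by deriv.
    by rewrite /= mulr0 addr0 mulr1 mulrC.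
  by rewrite add0r mulr_sumr.
eapply is_derive_eq.
  eapply fderivD; last by deriv.
  eapply fderivD; first by deriv.
  eapply fderivM; first exact: fderiv_cst.
  eapply fderivD; first by deriv.
  eapply fderivN; exact: dE.
rewrite /= big_nat_recr//= [e q _]/scaled_monomial exprMn factS natrM.
have f0 : q`!%:R != 0 :> R by rewrite pnatr_eq0 -lt0n fact_gt0.
move: (\sum_(_ <= _ < _) _) (expR _) => S E.
have rq : r ^+ q != 0 by rewrite expf_neq0.
rewrite !exprS; move: (r ^+ q) (t ^+ q) (q`!%:R) rq f0 => rq tq f rq0 f0.
by rewrite /r; field; rewrite f0 rq0; exact: r0.
Qed.

Lemma integral_flux (t : R) : b != 0 -> 0 <= t ->
  \int[lebesgue_measure]_(tau in `[0, t]) (flux tau * expR (- (kappa * tau))) =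
  expR (- (kappa * t)) * (flux t - c * t ^+ p) / b.
Proof.
move=> b0; pose G (s : R) := expR (- (kappa * s)) * ((flux s - c * s ^+ p) / b).
have dG (s : R) : is_derive s 1 G (flux s * expR (- (kappa * s))).
  rewrite /G; eapply is_derive_eq.
    eapply fderivM; first by deriv.
    by eapply fderivM; [exact: is_derive_flux|exact: fderiv_cst].
  by rewrite /=; move: (flux s) (expR _) (s ^+ p) => fl E y; field.
have dflux (s : R) : {for s, continuous flux}.
  have -> : flux = fun s => (flux s - c * s ^+ p) + c * s ^+ p.
    by apply/funext => s'; rewrite subrK.
  apply: cvgD; first exact: (is_derive_continuous is_derive_flux).
  by apply: cvgM; [exact: cvg_cst|exact: exprn_continuous].
rewrite le_eqVlt => /predU1P[<-|t0].
  by rewrite set_itv1 Rintegral_set1 flux0 subrr mulr0 mul0r.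
have Gc := is_derive_continuous dG.
rewrite /Rintegral (@continuous_FTC2 _ _ G)//.
- by rewrite -EFinB /= /G flux0 subrr mul0r mulr0 subr0 mulrA.
- apply: continuous_subspaceT => s; apply: cvgM; first exact: dflux.
  have dexp (y : R) : is_derive y 1 (fun s => expR (- (kappa * s)))
      (expR (- (kappa * y)) * - kappa).
    by eapply is_derive_eq; [deriv|rewrite /= mulr0 addr0 mulr1].
  exact: (is_derive_continuous dexp).
- split.
  + by move=> s _; case: (dG s).
  + exact/cvg_at_right_filter/Gc.
  + exact/cvg_at_left_filter/Gc.
- by move=> s _; rewrite derive1E; case: (dG s).
Qed.

End Flux.
End ExplicitSolutions.

Section FluxFormulas.
Context {R : realType}.
Variables (nu lambda mu eta : R) (p : nat).
Let sigma := lambda + nu * mu.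
Let delta := lambda - nu * mu.

Let sgnE : (-1) ^ (p%:Z - 1) = - (-1) ^+ p :> R.
Proof.
case: p => [|q]; first by rewrite expr0 exprN1 invrN1.
by rewrite -addn1 PoszD addrK -exprnP addn1 exprS mulN1r opprK.
Qed.

Let exp_sum_recl (q : nat) (x : R) :
  exp_sum q.+1 x = 1 + \sum_(1 <= k < q.+1) x ^+ k / k`!%:R.
Proof. by rewrite /exp_sum big_ltn// {1}/scaled_monomial expr0 fact0 divr1. Qed.

Let exp_sum_powers (q : nat) (a t : R) :
  \sum_(1 <= k < q) a ^+ k / k`!%:R * t ^+ k + 1 = exp_sum q.-1.+1 (a * t).
Proof.
rewrite exp_sum_recl addrC; congr (_ + _); case: q => [|q]; first by rewrite !big_geq.
by apply: eq_bigr => k _; rewrite exprMn mulrAC.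
Qed.

Let fact_neq0 n : n`!%:R != 0 :> R.
Proof. by rewrite pnatr_eq0 -lt0n fact_gt0. Qed.

Lemma V1_flux (t : R) : nu * lambda != 0 ->
  V1 nu lambda eta p t = flux 0 (- (nu * lambda)) (c eta p) p t.
Proof.
move=> a0; have p1E : p1 nu lambda eta p t =
    c1 nu lambda eta p * exp_sum p (- (nu * lambda) * t).
  rewrite /p1; case: p => [|[|[|q]]].
  - by rewrite /exp_sum big_geq// mulr0.
  - by rewrite exp_sum_recl big_geq// addr0 mulr1.
  - by rewrite exp_sum_recl big_nat1 expr1 divr1; ring.
  - by rewrite exp_sum_powers.
have c1E : c1 nu lambda eta p = - (c eta p * p`!%:R / (- (nu * lambda)) ^+ p).
  by rewrite /c1 sgnE [(- (nu * _)) ^+ _]exprNn invfM invr_sign; ring.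
have r0 : - (nu * lambda) != 0 by rewrite oppr_eq0.
rewrite /V1 p1E c1E /flux -[- (nu * lambda * t)]mulNr addr0 exprS.
move: (- (nu * lambda)) r0 (exp_sum _ _) (expR _) => r r0 S E.
have : r ^+ p != 0 by rewrite expf_neq0.
by move: (r ^+ p) => rp rp0; field; rewrite rp0 r0.
Qed.

Hypotheses (lambda0 : lambda != 0) (nu0 : nu != 0) (mu0 : mu != 0).

Lemma V2_flux (t : R) : sigma != 0 ->
  V2 nu lambda mu eta p t =
  flux (lambda ^+ 2) (nu * mu * lambda) (c eta p) p t.
Proof.
move=> s0; have p2E : p2 nu lambda mu eta p t =
    c eta p * lambda / sigma * t ^+ p
    - c2 nu lambda mu eta p * exp_sum p (lambda * sigma * t).
  rewrite /p2 /c2 -/sigma; case: p => [|[|[|q]]].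
  - by rewrite /exp_sum big_geq// c_factE double0 factS fact0; field.
  - by rewrite exp_sum_recl big_geq// addr0 factS fact0; field;
      rewrite s0 lambda0 nu0 mu0.
  - by rewrite exp_sum_recl big_nat1 expr1 divr1 !factS fact0; field;
      rewrite s0 lambda0 nu0 mu0.
  - by rewrite exp_sum_powers.
have rE : nu * mu * lambda + lambda ^+ 2 = lambda * sigma by rewrite /sigma; ring.
rewrite /V2 p2E /c2 -/sigma /flux rE.
move: (exp_sum _ _) (expR _) => S E.
rewrite [(lambda * sigma) ^+ p.+1]exprS.
have : (lambda * sigma) ^+ p != 0 by rewrite expf_neq0// mulf_neq0.
by move: ((lambda * sigma) ^+ p) => rp rp0; field; rewrite rp0 s0 lambda0.
Qed.

Lemma V3_flux (t : R) : delta != 0 ->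
  V3 nu lambda mu eta p t =
  flux (- lambda ^+ 2) (nu * mu * lambda) (c eta p) p t.
Proof.
move=> d0; have p3E : p3 nu lambda mu eta p t =
    c eta p * lambda / delta * t ^+ p
    - c3 nu lambda mu eta p * exp_sum p (- (lambda * delta) * t).
  rewrite /p3 /c3 -/delta sgnE; case: p => [|[|[|q]]].
  - by rewrite /exp_sum big_geq// c_factE double0 factS fact0; field.
  - by rewrite exp_sum_recl big_geq// addr0 factS fact0; field;
      rewrite d0 lambda0 nu0 mu0.
  - by rewrite exp_sum_recl big_nat1 expr1 divr1 !factS fact0; field;
      rewrite d0 lambda0 nu0 mu0.
  - by rewrite exp_sum_powers.
have rE : nu * mu * lambda - lambda ^+ 2 = - (lambda * delta) by rewrite /delta; ring.
have c3E : c3 nu lambda mu eta p = - (c eta p * nu * mu * p`!%:R /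
    (delta * (- (lambda * delta)) ^+ p)).
  rewrite /c3 -/delta sgnE [(- (lambda * _)) ^+ p]exprNn (mulrCA delta).
  rewrite [(_ * (delta * _))^-1]invfM.
  by rewrite invr_sign; ring.
rewrite /V3 p3E c3E /flux rE -[- (lambda * delta * t)]mulNr.
move: (exp_sum _ _) (expR _) => S E.
rewrite [(- (lambda * delta)) ^+ p.+1]exprS; have : (- (lambda * delta)) ^+ p != 0.
  by rewrite expf_neq0// oppr_eq0 mulf_neq0.
by move: ((- (lambda * delta)) ^+ p) => rp rp0; field; rewrite rp0 d0 lambda0.
Qed.

End FluxFormulas.

Section FluxSolution.
Context {R : realType}.
Variables (Phi h g : R -> R) (F v : R -> R -> R).
Hypothesis g0 : forall t : R, 0 < t -> g t = 0.
Variables (nu kappa b eta : R) (p : nat).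
Hypotheses (b0 : b != 0) (r0 : b + kappa != 0).
Hypothesis FE : forall V t : R, 0 < t -> F V t = nu * V.
Hypothesis hE : forall x : R, 0 < x -> h x = eta * p.*2.+1%:R * x ^+ p.*2.
Hypothesis PhiE : forall x : R, 0 < x -> nu * Phi x = - (b * profile kappa 1 x).

Let fl := flux kappa b (c eta p) p.
Let W (t : R) := fl t - c eta p * t ^+ p.
Let A := eta * p.*2.+1`!%:R.
Let w (x t : R) := A * heat_poly p x t + profile kappa 1 x * W t.
Let wx (x t : R) := A * dx_heat_poly p x t + dprofile kappa 1 x * W t.

Let is_derive_w (x t : R) : is_derive x 1 (w^~ t) (wx x t).
Proof.
eapply is_derive_eq.
  eapply fderivD.
    by eapply fderivM; [exact: fderiv_cst|exact: is_derive_heat_poly_x].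
  by eapply fderivM; [exact: is_derive_profile|exact: fderiv_cst].
by rewrite /wx /= !mulr0 addr0 add0r; ring.
Qed.

Let is_derive_wx (x t : R) :
  is_derive x 1 (wx^~ t) (A * dt_heat_poly p x t + kappa * profile kappa 1 x * W t).
Proof.
eapply is_derive_eq.
  eapply fderivD.
    by eapply fderivM; [exact: fderiv_cst|exact: is_derive_dx_heat_poly].
  by eapply fderivM; [exact: is_derive_dprofile|exact: fderiv_cst].
by rewrite /= !mulr0 addr0 add0r; ring.
Qed.

Let is_derive_wt (x t : R) : is_derive t 1 (w x)
  (A * dt_heat_poly p x t + profile kappa 1 x * (kappa * W t + b * fl t)).
Proof.
eapply is_derive_eq.
  eapply fderivD.
    by eapply fderivM; [exact: fderiv_cst|exact: is_derive_heat_poly_t].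
  by eapply fderivM; [exact: fderiv_cst|exact: is_derive_flux].
by rewrite /= !mulr0 !addr0.
Qed.

Let w_x0 (t : R) : w 0 t = fl t.
Proof.
rewrite /w heat_poly_x0 profile_at0 mul1r /W /A c_factE /scaled_monomial.
by field; rewrite pnatr_eq0 -lt0n fact_gt0.
Qed.

Let w_t0 (x : R) : w x 0 = eta * p.*2.+1%:R * x ^+ p.*2.
Proof.
rewrite /w heat_poly_t0 /W /fl flux0// subrr mulr0 addr0 /A /scaled_monomial factS natrM.
by field; rewrite pnatr_eq0 -lt0n fact_gt0.
Qed.

Lemma flux_classical_solution :
  (forall x t, 0 <= x -> 0 <= t -> v x t =
    eta * p.*2.+1`!%:R * heat_poly p x t
    + profile kappa 1 x * (flux kappa b (c eta p) p t - c eta p * t ^+ p)) ->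
  classical_solution Phi F h g v.
Proof.
move=> vw; split; last first.
  move=> x t x0 t0.
  apply: (@heat_equation_at_eq _ _ _ _ w (wx^~ t) _ _ _ _ x0 t0 vw
    (fun y _ => is_derive_w y t) (is_derive_wx x t) (is_derive_wt x t)).
  rewrite FE// w_x0; transitivity (b * profile kappa 1 x * fl t); first by ring.
  by rewrite -[b * _]opprK -PhiE//; ring.
have Wc : continuous W := is_derive_continuous (is_derive_flux (c eta p) p r0).
have wc : continuous (fun z : R * R => w z.1 z.2).
  move=> z; apply: cvgD.
    by apply: cvgM; [exact: cvg_cst|exact: continuous_heat_poly].
  exact: (continuous_separated (@continuous_profile _ kappa 1) Wc).
split.
- exact: within_quadrant_continuous vw wc.
- move=> x t x0 t0; suff [] : is_derive x 1 (v^~ t) (wx x t) by [].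
  apply: (@near_pos_is_derive _ _ (w^~ t)) => // y y0.
  by rewrite vw// ltW.
- by move=> x x0; rewrite vw ?(ltW x0)// hE// -w_t0.
- move=> t t0; rewrite g0//.
  have wx0 : wx 0 t = 0 by rewrite /wx dx_heat_poly_x0 dprofile_at0 mulr0 mul0r addr0.
  have := is_derive_w 0 t; rewrite wx0 => /is_derive0_cvg.
  apply: cvg_trans; apply: near_eq_cvg; near=> x.
  have x0 : 0 < x by [].
  by rewrite !vw// ?(ltW x0) ?(ltW t0).
Unshelve. all: by end_near. Qed.

End FluxSolution.

Section PowerData.
Context {R : realType}.
Variables (Phi h g : R -> R) (F v : R -> R -> R).
Hypothesis g0 : forall t : R, 0 < t -> g t = 0.
Variables (nu eta lambda mu : R) (p : nat).
Hypotheses (nu0 : 0 < nu) (lambda0 : 0 < lambda) (mu0 : 0 < mu).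
Hypothesis FE : forall V t : R, 0 < t -> F V t = nu * V.
Hypothesis hE : forall x : R, 0 < x -> h x = eta * p.*2.+1%:R * x ^+ p.*2.

Lemma u1_classical_solution : (forall x, 0 < x -> Phi x = lambda) ->
  (forall x t, 0 <= x -> 0 <= t ->
    v x t = derive1 (fun y => u1 nu lambda eta p y t) x) ->
  classical_solution Phi F h g v.
Proof.
move=> PhiE vE; have a0 : nu * lambda != 0 by rewrite mulf_neq0 ?gt_eqF.
have b0 : - (nu * lambda) != 0 by rewrite oppr_eq0.
have r0 : - (nu * lambda) + 0 != 0 by rewrite addr0.
apply: (flux_classical_solution g0 r0 FE hE).
  by move=> x x0; rewrite PhiE// profile0 mulr1 opprK.
move=> x t x0 t0; rewrite vE// derive1E profile0 mul1r.
suff [_ ->] : is_derive x 1 (fun y => u1 nu lambda eta p y t)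
    (eta * p.*2.+1`!%:R * heat_poly p x t
     + (flux 0 (- (nu * lambda)) (c eta p) p t - c eta p * t ^+ p)) by [].
rewrite /u1 /phi1.
have -> : \int[lebesgue_measure]_(tau in `[0, t]) V1 nu lambda eta p tau =
    (flux 0 (- (nu * lambda)) (c eta p) p t - c eta p * t ^+ p) / - (nu * lambda).
  rewrite -[X in X / _]mul1r -(expR0 R) -[X in expR X]oppr0 -{2}(mul0r t).
  rewrite -(integral_flux _ _ r0)//; apply: eq_Rintegral => s _.
  by rewrite V1_flux// mul0r oppr0 expR0 mulr1.
eapply is_derive_eq; first by eapply fderivD; [exact: is_derive_u0|deriv].
by rewrite /=; move: (flux _ _ _ _ _ - _) => W; field; rewrite !gt_eqF.
Qed.

Lemma u2_classical_solution : lambda + nu * mu != 0 ->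
  (forall x, 0 < x -> Phi x = - (mu * lambda) * cosh (lambda * x)) ->
  (forall x t, 0 <= x -> 0 <= t ->
    v x t = derive1 (fun y => u2 nu lambda mu eta p y t) x) ->
  classical_solution Phi F h g v.
Proof.
move=> s0 PhiE vE.
have b0 : nu * mu * lambda != 0 by rewrite !mulf_neq0 ?gt_eqF.
have r0 : nu * mu * lambda + lambda ^+ 2 != 0.
  rewrite (_ : _ + _ = lambda * (lambda + nu * mu)); last by ring.
  by rewrite mulf_neq0// gt_eqF.
apply: (flux_classical_solution g0 r0 FE hE).
  by move=> x x0; rewrite PhiE// profile_sqr//; ring.
move=> x t x0 t0; rewrite vE// derive1E profile_sqr// mul1r.
suff [_ ->] : is_derive x 1 (fun y => u2 nu lambda mu eta p y t)
    (eta * p.*2.+1`!%:R * heat_poly p x t + cosh (lambda * x) *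
     (flux (lambda ^+ 2) (nu * mu * lambda) (c eta p) p t - c eta p * t ^+ p)) by [].
rewrite /u2 /phi2 /sinh /cosh.
have -> : \int[lebesgue_measure]_(tau in `[0, t])
      (V2 nu lambda mu eta p tau * expR (- (lambda ^+ 2 * tau))) =
    expR (- (lambda ^+ 2 * t)) * (flux (lambda ^+ 2) (nu * mu * lambda) (c eta p) p t
      - c eta p * t ^+ p) / (nu * mu * lambda).
  rewrite -(integral_flux _ _ r0)//; apply: eq_Rintegral => s _.
  by congr (_ * _); apply: V2_flux => //; exact: lt0r_neq0.
eapply is_derive_eq; first by eapply fderivD; [exact: is_derive_u0|deriv].
have E0 := @expR_eq0 R (lambda ^+ 2 * t).
rewrite /= (expRN (lambda ^+ 2 * t)).
move: (flux _ _ _ _ _ - _) (expR (_ * t)) E0 => W E E0.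
by field; rewrite E0 !gt_eqF.
Qed.

Lemma u3_classical_solution : lambda - nu * mu != 0 ->
  (forall x, 0 < x -> Phi x = - (mu * lambda) * cos (lambda * x)) ->
  (forall x t, 0 <= x -> 0 <= t ->
    v x t = derive1 (fun y => u3 nu lambda mu eta p y t) x) ->
  classical_solution Phi F h g v.
Proof.
move=> s0 PhiE vE.
have b0 : nu * mu * lambda != 0 by rewrite !mulf_neq0 ?gt_eqF.
have r0 : nu * mu * lambda - lambda ^+ 2 != 0.
  rewrite (_ : _ - _ = - (lambda * (lambda - nu * mu))); last by ring.
  by rewrite oppr_eq0 mulf_neq0// gt_eqF.
apply: (flux_classical_solution g0 r0 FE hE).
  by move=> x x0; rewrite PhiE// profileN_sqr//; ring.
move=> x t x0 t0; rewrite vE// derive1E profileN_sqr// mul1r.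
suff [_ ->] : is_derive x 1 (fun y => u3 nu lambda mu eta p y t)
    (eta * p.*2.+1`!%:R * heat_poly p x t + cos (lambda * x) *
     (flux (- lambda ^+ 2) (nu * mu * lambda) (c eta p) p t - c eta p * t ^+ p)) by [].
rewrite /u3 /phi3.
have -> : \int[lebesgue_measure]_(tau in `[0, t])
      (V3 nu lambda mu eta p tau * expR (lambda ^+ 2 * tau)) =
    expR (lambda ^+ 2 * t) * (flux (- lambda ^+ 2) (nu * mu * lambda) (c eta p) p t
      - c eta p * t ^+ p) / (nu * mu * lambda).
  rewrite -[lambda ^+ 2 * t]opprK -mulNr -(integral_flux _ _ r0)//.
  apply: eq_Rintegral => s _; rewrite mulNr opprK; congr (_ * _).
  by apply: V3_flux => //; exact: lt0r_neq0.
eapply is_derive_eq; first by eapply fderivD; [exact: is_derive_u0|deriv].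
have E0 := @expR_eq0 R (lambda ^+ 2 * t).
rewrite /= (expRN (lambda ^+ 2 * t)).
move: (flux _ _ _ _ _ - _) (expR (_ * t)) E0 => W E E0.
by field; rewrite E0 !gt_eqF.
Qed.

End PowerData.

Theorem proposition4p1 (R : realType) (Phi h g : R -> R) (F v : R -> R -> R)
    (g0 : forall t : R, 0 < t -> g t = 0) :
  [/\ (* 1 *)
      (forall x t : R, 0 <= x -> 0 <= t -> v x t = h x) ->
      ((forall V t : R, 0 < t -> F V t = 0) ->
       (exists a : R, forall x : R, 0 <= x -> h x = a) ->
       classical_solution Phi F h g v /\ time_independent v) /\
      (forall k : R, k != 0 ->
       (forall V t : R, 0 < t -> F V t = k) ->
       locally_integrable `]0, +oo[ Phi ->
       (forall x : R, 0 < x ->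
          (@lebesgue_measure R).-integrable `]0, x] (EFin \o Phi)) ->
       h x @[x --> 0^'+] --> h 0 ->
       (forall x : R, 0 < x -> derivable h x 1) ->
       (forall x : R, 0 < x ->
          derive1 h x = k * \int[lebesgue_measure]_(xi in `]0, x]) Phi xi) ->
       [/\ caratheodory_solution Phi F h g v,
           (forall x : R, 0 < x -> {for x, continuous Phi}) ->
             classical_solution Phi F h g v &
           time_independent v]),
      (* 2 *)
      forall lambda eta delta sigma : R,
      lambda != 0 -> eta != 0 -> delta != 0 ->
      [\/ exists2 nu : R, nu != 0 &
            forall V t : R, 0 < t -> F V t = nu * V,
          exists f1 f2 : R -> R,
            [/\ locally_integrable `]0, +oo[ f1,
                locally_integrable `]0, +oo[ f2 &
                forall V t : R, 0 < t -> F V t = f1 t + f2 t * V] |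
          exists (n : R) (f : R -> R),
            [/\ n < 1,
                locally_integrable `]0, +oo[ f,
                forall t : R, 0 < t -> 0 < f t,
                [/\ 0 < lambda, 0 < delta & 0 < eta] &
                forall V t : R, 0 < V -> 0 < t -> F V t = V `^ n * f t]] ->
      (forall x : R, 0 < x -> h x = eta * profile sigma delta x) ->
      (forall x : R, 0 < x -> Phi x = lambda * profile sigma delta x) ->
      forall T : R -> R,
      (forall x t : R, 0 <= x -> 0 <= t -> v x t = profile sigma delta x * T t) ->
      [/\ classical_ivp_solution sigma delta lambda eta F T ->
            classical_solution Phi F h g v,
          caratheodory_ivp_solution sigma delta lambda eta F T ->
            caratheodory_solution Phi F h g v &
          separated_variables v] &
      (* 3 *)
      forall (nu eta' lambda' mu' : R) (l p : nat),
      0 < nu -> eta' != 0 -> 0 < lambda' -> 0 < mu' -> l = p.*2 ->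
      (forall V t : R, 0 < t -> F V t = nu * V) ->
      (forall x : R, 0 < x -> h x = eta' * x ^+ l) ->
      let m := l.+1 in
      let eta := eta' / m%:R in
      let lambda := lambda' in
      let mu := mu' / lambda' in
      [/\ (forall x : R, 0 < x -> Phi x = lambda') ->
          (forall x t : R, 0 <= x -> 0 <= t ->
             v x t = derive1 (fun y => u1 nu lambda eta p y t) x) ->
          classical_solution Phi F h g v,
          (forall x : R, 0 < x -> Phi x = - mu' * cosh (lambda' * x)) ->
          lambda + nu * mu != 0 ->
          (forall x t : R, 0 <= x -> 0 <= t ->
             v x t = derive1 (fun y => u2 nu lambda mu eta p y t) x) ->
          classical_solution Phi F h g v &
          (forall x : R, 0 < x -> Phi x = - mu' * cos (lambda' * x)) ->
          lambda - nu * mu != 0 ->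
          (forall x t : R, 0 <= x -> 0 <= t ->
             v x t = derive1 (fun y => u3 nu lambda mu eta p y t) x) ->
          classical_solution Phi F h g v]].
Proof.
split.
- move=> vE; split=> [F0 [a ha]|k _ Fk locPhi intPhi h0 dh h'E].
    split; last exact: stationary_time_independent vE.
    exact: constant_classical_solution F0 ha.
  split; last exact: stationary_time_independent vE.
  + exact: (stationary_caratheodory_solution g0 vE Fk intPhi h0 dh h'E locPhi).
  + exact: (stationary_classical_solution g0 vE Fk intPhi h0 dh h'E).
- move=> lambda eta delta sigma _ _ _ _ hE PhiE T vE; split.
  + exact: (profile_classical_solution g0 hE PhiE vE).
  + exact: (profile_caratheodory_solution g0 hE PhiE vE).
  + by exists (profile sigma delta), T.
- move=> nu eta' lambda mu' l p nu0 _ lambda0 mu'0 -> FE hE m eta lambda' mu.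
  have {}hE (x : R) : 0 < x -> h x = eta * p.*2.+1%:R * x ^+ p.*2.
    by move=> x0; rewrite hE// /eta /m divfK// pnatr_eq0.
  have mu0 : 0 < mu by exact: divr_gt0.
  have muE : mu * lambda = mu' by rewrite divfK// gt_eqF.
  split.
  + exact: u1_classical_solution.
  + move=> PhiE s0; apply: u2_classical_solution => //.
    by rewrite muE.
  + move=> PhiE d0; apply: u3_classical_solution => //.
    by rewrite muE.
Qed.
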